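(* Let $r\ge1$ and suppose $\beta(x)=\gamma(x)=0$ for all $x\in\Omega$. Let $u\in W^{2r+1,\infty}_{\mathcal P}(\Omega)$ be the solution of $$-(\alpha u')'=f\ \text{ in }\Omega,\qquad u(a)=u(b)=0,$$ and let $u_{\mathcal P}\in U^r_{\mathcal P}$ be the solution of the finite volume scheme $a_{\mathcal P}(u_{\mathcal P},w)=\int_a^bfw\,dx$ for all $w\in V_{\mathcal P'}$. Then for all $1\le i\le N$, $1\le j\le r$, $$|u'(g_{i,j})-u_{\mathcal P}'(g_{i,j})|\le C\,h^{2r}\sum_{k=r+1}^{2r+1}|u|_{k,\infty,\mathcal P},$$ with a constant $C$ independent of $\mathcal P$, $i$, $j$ and $u$.
   Context: Coefficients. $\Omega=(a,b)$ is an interval; $\alpha\in L^\infty(\bar\Omega)$ with $\alpha\ge\alpha_0>0$; $f$ is a real-valued function on $\bar\Omega$. ($\beta$ and $\gamma$ are the lower-order coefficients in the general equation $-(\alpha u')'+\beta u'+\gamma u=f$.) Primal mesh. For $a=x_0<\dots<x_N=b$ put $\tau_i=[x_{i-1},x_i]$, $h_i=x_i-x_{i-1}$, $h=\max_ih_i$, $\mathcal P=\{\tau_i\}_{i=1}^N$. The trial space is $U^r_{\mathcal P}=\{v\in C(\Omega): v|_{\tau_i}$ is a polynomial of degree $\le r$ for each $i$, $v(a)=v(b)=0\}$. Broken spaces: $W^{m,\infty}_{\mathcal P}(\Omega)=\{v\in C(\Omega): v|_{\tau_i}\in W^{m,\infty}(\tau_i)\ \forall i\}$; seminorms $|v|_{k,\infty,\mathcal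 P}=\max_i\|v^{(k)}\|_{L^\infty(\tau_i)}$. Dual mesh. Let $G_1<\dots<G_r$ be the zeros in $[-1,1]$ of the Legendre polynomial of degree $r$; the Gauss points are $g_{i,j}=\tfrac12(x_i+x_{i-1}+h_iG_j)$ for $1\le i\le N$, $1\le j\le r$, and $g_{i,r+1}=g_{i+1,1}$ for $1\le i\le N-1$. Put $r_i=r$ for $i\le N-1$ and $r_N=r-1$. The test space $V_{\mathcal P'}$ consists of $w=\sum_{i=1}^N\sum_{j=1}^{r_i}w_{i,j}\chi_{[g_{i,j},g_{i,j+1}]}$, $w_{i,j}\in\mathbb R$, where $\chi$ denotes a characteristic function. With $w_{1,0}=0$, $w_{N,r}=0$, $w_{i,0}=w_{i-1,r}$ ($2\le i\le N$), the jumps are $[w_{i,j}]=w_{i,j}-w_{i,j-1}$ for $1\le i\le N$, $1\le j\le r$. Bilinear form (with $\beta=\gamma=0$). $$a_{\mathcal P}(v,w)=\sum_{i=1}^N\sum_{j=1}^r[w_{i,j}]\,\alpha(g_{i,j})v'(g_{i,j}).$$ *)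

(* Defs.v *)
From HB Require Import structures.
From mathcomp Require Import all_boot all_order all_algebra.
From mathcomp Require Import all_classical all_reals all_analysis.

Set Implicit Arguments.
Unset Strict Implicit.
Unset Printing Implicit Defensive.

Import Order.TTheory GRing.Theory Num.Theory.
Import numFieldNormedType.Exports.

Local Open Scope classical_set_scope.
Local Open Scope ring_scope.

(* The open interval is used throughout for a cell [x, y]: its end points are
   null sets for the norms and the integrals below. *)

Definition Linf_norm (R : realType) (x y : R) (g : R -> R) : \bar R :=
  ('N[mrestr lebesgue_measure (measurable_itv `]x, y[)]_+oo[EFin \o g])%E.

Definition Linf (R : realType) (x y : R) (g : R -> R) : Prop :=
  measurable_fun `]x, y[ g /\ (Linf_norm x y g < +oo)%E.

Definition C1c (R : realType) (x y : R) (phi : R -> R) : Prop :=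
  [/\ forall t, derivable phi t 1,
      continuous (derive1 phi) &
      exists c d, [/\ x < c, d < y & forall t, t \notin `[c, d] -> phi t = 0]].

(* Weak derivatives and W^{m,oo} on an interval, by induction on the order and
   with C^1_c test functions, as in Brezis, Functional Analysis, Sobolev Spaces
   and PDEs, Chapter 8. Local integrability of v and g is to be provided
   separately. *)
Definition weak_deriv (R : realType) (x y : R) (v g : R -> R) : Prop :=
  forall phi, C1c x y phi ->
    \int[lebesgue_measure]_(t in `]x, y[) (v t * derive1 phi t) =
    - \int[lebesgue_measure]_(t in `]x, y[) (g t * phi t).

(* v and its successive weak derivatives up to g, the k-th one, are in L^oo *)
Fixpoint weak_derivn (R : realType) (x y : R) (k : nat) (v g : R -> R) : Prop :=
  Linf x y v /\
  if k is k'.+1 then exists2 v1, weak_deriv x y v v1 & weak_derivn x y k' v1 g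
  else g = v.

Definition Winf (R : realType) (x y : R) (m : nat) (v : R -> R) : Prop :=
  exists g, weak_derivn x y m v g.

(* L^oo norm of the k-th weak derivative of v. That derivative is unique up to
   a null set, so the norm does not depend on the representative chosen by
   xget. *)
Definition Winf_seminorm (R : realType) (x y : R) (k : nat) (v : R -> R)
    : \bar R :=
  Linf_norm x y (xget (cst 0) [set g | weak_derivn x y k v g]).

(* A mesh with N cells is given by its nodes x 0 < ... < x N; the i-th cell
   (1 <= i <= N) is [x i.-1, x i]. *)
Definition is_mesh (R : realType) (a b : R) (N : nat) (x : nat -> R) : Prop :=
  [/\ x 0%N = a, x N = b & forall i, (1 <= i <= N)%N -> x i.-1 < x i].

Definition cell_size (R : realType) (x : nat -> R) (i : nat) : R :=
  x i - x i.-1.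

Definition mesh_size (R : realType) (N : nat) (x : nat -> R) : R :=
  \big[Num.max/0]_(1 <= i < N.+1) cell_size x i.

Definition trial_space (R : realType) (a b : R) (r N : nat) (x : nat -> R)
    (v : R -> R) : Prop :=
  [/\ {within `[a, b], continuous v},
      forall i, (1 <= i <= N)%N -> exists2 p : {poly R}, (size p <= r.+1)%N &
        forall t, t \in `[x i.-1, x i] -> v t = p.[t],
      v a = 0 & v b = 0].

Definition broken_Winf (R : realType) (a b : R) (N : nat) (x : nat -> R)
    (m : nat) (v : R -> R) : Prop :=
  {within `[a, b], continuous v} /\
  forall i, (1 <= i <= N)%N -> Winf (x i.-1) (x i) m v.

Definition broken_seminorm (R : realType) (N : nat) (x : nat -> R) (k : nat)
    (v : R -> R) : \bar R :=
  \big[Order.max/0%E]_(1 <= i < N.+1) Winf_seminorm (x i.-1) (x i) k v.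

(* Rodrigues' formula *)
Definition legendre (R : realType) (r : nat) : {poly R} :=
  (2 ^+ r * (r`!)%:R)^-1 *: (('X ^+ 2 - 1) ^+ r)^`(r).

Definition legendre_zeros (R : realType) (r : nat) (G : nat -> R) : Prop :=
  (forall j, (1 <= j < r)%N -> G j < G j.+1) /\
  forall t, t \in `[-1, 1] /\ root (legendre R r) t <->
            exists2 j, (1 <= j <= r)%N & t = G j.

Definition gauss_point (R : realType) (r : nat) (G x : nat -> R) (i j : nat)
    : R :=
  let g i j := (x i + x i.-1 + cell_size x i * G j) / 2 in
  if j == r.+1 then g i.+1 1%N else g i j.

(* Elements of the test space are given by their coefficients w i j, for
   1 <= i <= N and 1 <= j <= dual_count r N i. *)
Definition dual_count (r N i : nat) : nat := if i == N then r.-1 else r.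

Definition test_fun (R : realType) (r N : nat) (G x : nat -> R)
    (w : nat -> nat -> R) (t : R) : R :=
  \sum_(1 <= i < N.+1) \sum_(1 <= j < (dual_count r N i).+1)
    w i j * \1_(`[gauss_point r G x i j, gauss_point r G x i j.+1]) t.

(* w i j with the conventions w 1 0 = 0, w N r = 0 and w i 0 = w (i - 1) r *)
Definition test_coef (R : realType) (r N : nat) (w : nat -> nat -> R)
    (i j : nat) : R :=
  if j == 0%N then (if i == 1%N then 0 else w i.-1 r)
  else if (i == N) && (j == r) then 0 else w i j.

Definition jump (R : realType) (r N : nat) (w : nat -> nat -> R) (i j : nat)
    : R :=
  test_coef r N w i j - test_coef r N w i j.-1.

Definition fv_form (R : realType) (r N : nat) (G x : nat -> R)
    (alpha v : R -> R) (w : nat -> nat -> R) : R :=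
  \sum_(1 <= i < N.+1) \sum_(1 <= j < r.+1)
    jump r N w i j * (alpha (gauss_point r G x i j)
                      * derive1 v (gauss_point r G x i j)).

Definition fv_solution (R : realType) (a b : R) (r N : nat) (G x : nat -> R)
    (alpha f uP : R -> R) : Prop :=
  trial_space a b r N x uP /\
  forall w : nat -> nat -> R,
    fv_form r N G x alpha uP w =
    \int[lebesgue_measure]_(t in `[a, b]) (f t * test_fun r N G x w t).

(* The scheme evaluates alpha at points, so alpha is a function and not a class
   modulo null sets, and its bounds hold everywhere. *)
Definition diffusion_coef (R : realType) (a b : R) (alpha0 : R)
    (alpha : R -> R) : Prop :=
  [/\ measurable_fun `[a, b] alpha,
      [bounded alpha t | t in `[a, b]],
      0 < alpha0 &
      forall t, t \in `[a, b] -> alpha0 <= alpha t].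

(* - (alpha u')' = f with homogeneous Dirichlet conditions: the flux
   q = alpha u' is a continuous function with weak derivative - f. The identity
   q = alpha u' is pointwise, for the same reason as above; it is only asked
   inside the cells, since u' need not exist at the nodes. *)
Definition bvp_solution (R : realType) (a b : R) (N : nat) (x : nat -> R)
    (alpha f u : R -> R) : Prop :=
  [/\ u a = 0, u b = 0,
      lebesgue_measure.-integrable `[a, b] (EFin \o f) &
      exists q : R -> R,
        [/\ {within `[a, b], continuous q},
            weak_deriv a b q (fun t => - f t) &
            forall i t, (1 <= i <= N)%N -> t \in `]x i.-1, x i[ ->
              q t = alpha t * derive1 u t]].

(* Main.v *)
(** Testing the scheme with the indicator of one dual cell and integrating
    -(alpha u')' = f over that cell shows that alpha (u' - uP') takes the same
    value c at all Gauss points. To bound c, divide by alpha and sum against the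
    Gauss weights. The uP-part of the quadrature is exact, and both integrals
    over (a, b) vanish because of the boundary conditions. Hence c, times a
    weighted sum of 1 / alpha that is at least (b - a) / max alpha, equals the
    quadrature error for u', which is of order h^(2r) since Gauss quadrature is
    exact up to degree 2r - 1. On each cell, u is a polynomial of degree at most
    2r up to a remainder controlled by its weak derivative of order 2r + 1; this
    follows from the du Bois-Reymond lemma: a function with an integrable weak
    derivative is a.e. an indefinite integral of it. *)

Require Import Defs.
From HB Require Import structures.
From mathcomp Require Import all_boot all_order all_algebra.
From mathcomp Require Import all_classical all_reals all_analysis.
From mathcomp Require Import measurable_realfun ess_sup_inf ring lra zify.

Set Implicit Arguments.
Unset Strict Implicit.
Unset Printing Implicit Defensive.

Import Order.TTheory GRing.Theory Num.Theory.
Import numFieldNormedType.Exports.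

Local Open Scope classical_set_scope.
Local Open Scope ring_scope.

(** * Gauss quadrature *)

(** Primitive vanishing at 0: the coefficient of index 0 is a division by [0%:R], which is 0 by
    convention. *)
Definition polyint (R : realType) (p : {poly R}) : {poly R} :=
  \poly_(i < (size p).+1) (p`_i.-1 / i%:R).

Lemma coef_polyint (R : realType) (p : {poly R}) (i : nat) :
  (polyint p)`_i = p`_i.-1 / i%:R.
Proof.
rewrite coef_poly; case: ltnP => // hi.
by rewrite nth_default ?mul0r //; case: i hi.
Qed.

Lemma size_polyint (R : realType) (p : {poly R}) :
  (size (polyint p) <= (size p).+1)%N.
Proof. exact: size_poly. Qed.

Lemma polyint_is_linear (R : realType) : linear (@polyint R).
Proof.
move=> c p q; apply/polyP => i.
by rewrite coefD coefZ !coef_polyint coefD coefZ mulrDl mulrA.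
Qed.

HB.instance Definition _ (R : realType) :=
  GRing.isLinear.Build R {poly R} {poly R} *:%R (@polyint R)
    (@polyint_is_linear R).

Lemma deriv_polyint (R : realType) (p : {poly R}) : (polyint p)^`() = p.
Proof.
apply/polyP => i.
by rewrite coef_deriv coef_polyint -[LHS]mulr_natr divfK // pnatr_eq0.
Qed.

Lemma polyint_deriv (R : realType) (p : {poly R}) :
  polyint p^`() = p - (p`_0)%:P.
Proof.
apply/polyP => i; rewrite coef_polyint coefB coefC coef_deriv.
case: i => [|i] /=; first by rewrite invr0 mulr0 subrr.
by rewrite subr0 -[p`_i.+1 *+ _]mulr_natr mulfK // pnatr_eq0.
Qed.

(** Integral over [-1, 1] taken through the primitive, so that orthogonality and exactness stay
    purely algebraic. *)
Definition ref_int (R : realType) (p : {poly R}) : R :=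
  (polyint p).[1] - (polyint p).[-1].

Lemma ref_int_is_linear (R : realType) : linear_for *%R (@ref_int R).
Proof.
by move=> c p q; rewrite /ref_int linearP /= !(hornerD, hornerZ); ring.
Qed.

HB.instance Definition _ (R : realType) :=
  GRing.isLinear.Build R {poly R} R *%R (@ref_int R)
    (@ref_int_is_linear R).

Lemma ref_int_deriv (R : realType) (p : {poly R}) :
  ref_int p^`() = p.[1] - p.[-1].
Proof. by rewrite /ref_int polyint_deriv !hornerE; ring. Qed.

(** By the mean value theorem the integral is twice a value of [p]. *)
Lemma ref_int_ge0 (R : realType) (p : {poly R}) :
  (forall t, 0 <= p.[t]) -> 0 <= ref_int p.
Proof.
move=> p0; rewrite /ref_int.
have [|||c _ ->] := @MVT R (horner (polyint p)) (horner p) (-1) 1.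
- by rewrite -subr_gt0 opprK.
- by move=> t _; have := is_derive_poly (polyint p) t; rewrite deriv_polyint.
- by apply: continuous_subspaceT => t; exact: continuous_horner.
- by rewrite mulr_ge0 // opprK.
Qed.

(** Leibniz's rule keeping only the lowest order in X - c. With k < n it yields a root at [c], with
    k = n the value there. *)
Lemma derivn_XsubC_exp (R : realType) (c : R) (n k : nat) (q : {poly R}) :
  (k <= n)%N -> exists2 qk : {poly R},
    (('X - c%:P) ^+ n * q)^`(k) = ('X - c%:P) ^+ (n - k) * qk &
    qk.[c] = (n ^_ k)%:R * q.[c].
Proof.
elim: k => [_|k IH kn]; first by exists q; rewrite ?subn0 ?ffactn0 ?mul1r.
have [qk E qkc] := IH (ltnW kn).
exists (qk *+ (n - k) + ('X - c%:P) * qk^`()).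
  rewrite derivnS E derivM deriv_exp derivXsubC mul1r -subnS.
  have -> : (n - k = (n - k.+1).+1)%N by lia.
  rewrite exprS -mulr_natl -[qk *+ _]mulr_natl; ring.
rewrite !hornerE subrr mul0r addr0 hornerMn qkc ffactnSr natrM -mulr_natr; ring.
Qed.

(** * Legendre polynomials, their zeros and the Gauss weights *)

Section Quadrature.
Variables (R : realType) (r : nat).
Let D : {poly R} := ('X ^+ 2 - 1) ^+ r.

(** The condition [e ^+ 2 = 1] treats the end points 1 and -1 together. *)
Let DE (e : R) : e ^+ 2 = 1 -> D = ('X - e%:P) ^+ r * ('X + e%:P) ^+ r.
Proof.
move=> e2; rewrite -exprMn; congr (_ ^+ r).
by rewrite -[1 in LHS](polyC1 R) -e2 rmorphXn /=; ring.
Qed.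

Let D_root (e : R) (k : nat) : e ^+ 2 = 1 -> (k < r)%N -> D^`(k).[e] = 0.
Proof.
move=> e2 kr; rewrite (DE e2).
have [q -> _] := derivn_XsubC_exp e (('X + e%:P) ^+ r) (ltnW kr).
by rewrite hornerM horner_exp hornerXsubC subrr expr0n subn_eq0 leqNgt kr mul0r.
Qed.

(** The r-th derivative of (X - e)^r (X + e)^r at e is r! (2e)^r. This shows that the polynomial is
    non-zero and that its zeros avoid the end points. *)
Lemma legendre_sqr1_neq0 (e : R) : e ^+ 2 = 1 -> (legendre R r).[e] != 0.
Proof.
move=> e2; rewrite /legendre -/D (DE e2).
have [q -> qe] := derivn_XsubC_exp e (('X + e%:P) ^+ r) (leqnn r).
have e0 : e != 0 by apply: contra_eq_neq e2 => ->; rewrite expr0n eq_sym oner_eq0.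
rewrite subnn expr0 mul1r hornerZ qe horner_exp hornerD hornerX hornerC.
rewrite -mulr2n -[e *+ 2]mulr_natr.
have f0 n : n`!%:R != 0 :> R by rewrite pnatr_eq0 -lt0n fact_gt0.
have t0 n : 2 ^+ n != 0 :> R by rewrite expf_neq0 // pnatr_eq0.
rewrite ffactnn; apply: mulf_neq0; first by apply: invr_neq0; exact: mulf_neq0.
by apply: mulf_neq0 => //; apply: expf_neq0; apply: mulf_neq0; rewrite // pnatr_eq0.
Qed.

Lemma legendre_neq0 : legendre R r != 0.
Proof.
by apply: contraTneq (legendre_sqr1_neq0 (expr1n R 2)) => ->; rewrite horner0 eqxx.
Qed.

(* Repeated integration by parts: the boundary terms vanish because 1 and -1
   are roots of order r of (X^2 - 1)^r. *)
Lemma derivn_mul_primitive (k : nat) (s : {poly R}) :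
  (k <= r)%N -> (size s <= k)%N ->
  exists F, [/\ F^`() = D^`(k) * s, F.[1] = 0 & F.[-1] = 0].
Proof.
elim: k s => [|k IH] s kr ss.
  exists 0; move: ss; rewrite leqn0 size_poly_eq0 => /eqP ->.
  by rewrite mulr0 raddf0 !horner0.
have [] := IH s^`() (ltnW kr).
  have [->|s0] := eqVneq s 0; first by rewrite raddf0 size_poly0.
  by have := lt_size_deriv s0; lia.
move=> F [dF F1 FN1]; exists (D^`(k) * s - F).
split; first by rewrite derivB derivM dF derivnS; ring.
  by rewrite hornerD hornerN hornerM D_root ?expr1n // F1; ring.
by rewrite hornerD hornerN hornerM D_root ?sqrrN ?expr1n // FN1; ring.
Qed.

(** The product has a primitive vanishing at both end points: this is the orthogonality of the
    Legendre polynomial to lower degrees. *)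
Lemma ref_int_legendre_mul (s : {poly R}) :
  (size s <= r)%N -> ref_int (legendre R r * s) = 0.
Proof.
move=> ss; have [F [dF F1 FN1]] := derivn_mul_primitive (leqnn r) ss.
by rewrite /legendre -scalerAl linearZ /= -/D -dF ref_int_deriv F1 FN1 subrr mulr0.
Qed.

Lemma size_legendre : (size (legendre R r) <= r.+1)%N.
Proof.
have H k : (size D^`(k) <= (2 * r).+1 - k)%N.
  elim: k => [|k IH].
    rewrite subn0 derivn0; apply: (leq_trans (size_poly_exp_leq _ _)).
    by rewrite -[1](polyC1 R) -polyCN size_XnaddC.
  rewrite derivnS; have [->|n0] := eqVneq D^`(k) 0.
    by rewrite raddf0 size_poly0.
  by have := lt_size_deriv n0; lia.
apply: (leq_trans (size_scale_leq _ _)); apply: (leq_trans (H r)); lia.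
Qed.

Variable G : nat -> R.
Hypotheses (r0 : (0 < r)%N) (hG : legendre_zeros r G).

Lemma legendre_zeros_lt (j k : nat) :
  (1 <= j)%N -> (j < k)%N -> (k <= r)%N -> G j < G k.
Proof.
move=> j1; elim: k => // k IH; rewrite ltnS leq_eqVlt => /predU1P[<- ?|jk kr].
  by apply: hG.1; lia.
by apply: lt_trans (IH jk _) (hG.1 k _); lia.
Qed.

Lemma legendre_zeros_root (j : nat) : (1 <= j <= r)%N -> root (legendre R r) (G j).
Proof. by move=> jr; have /hG.2[] : exists2 k, (1 <= k <= r)%N & G j = G k by exists j. Qed.

(** The end points are not zeros, so Gauss points lie strictly inside their cells, where u' is
    meaningful. *)
Lemma legendre_zeros_itv (j : nat) : (1 <= j <= r)%N -> -1 < G j < 1.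
Proof.
move=> jr; have /hG.2[] : exists2 k, (1 <= k <= r)%N & G j = G k by exists j.
rewrite in_itv /= !le_eqVlt => /andP[/predU1P[E|->]].
  by rewrite -E rootE (negPf (legendre_sqr1_neq0 _)) // sqrrN expr1n.
by case/predU1P => [->|-> //]; rewrite rootE (negPf (legendre_sqr1_neq0 _)) ?expr1n.
Qed.

(** The lower bound on the degree comes from counting r distinct zeros. *)
Lemma size_legendre_zeros : size (legendre R r) = r.+1.
Proof.
apply/eqP; rewrite eqn_leq size_legendre /=.
rewrite -[X in (X < _)%N](size_iota 1 r) -(size_map G).
apply: (max_poly_roots legendre_neq0).
  apply/allP => t /mapP[j]; rewrite mem_iota => hj ->.
  by apply: legendre_zeros_root; lia.
rewrite map_inj_in_uniq ?iota_uniq // => j k; rewrite !mem_iota => hj hk E.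
case: (ltngtP j k) => // jk.
  suff : G j < G k by rewrite E ltxx.
  by apply: legendre_zeros_lt => //; lia.
suff : G k < G j by rewrite E ltxx.
by apply: legendre_zeros_lt => //; lia.
Qed.

(** Stated through a primitive [p] of degree at most 2r: the integrand is its derivative, of degree
    at most 2r - 1, and no integral appears in later uses. *)
Theorem gauss_quadrature : exists A : nat -> R,
  (forall j, (1 <= j <= r)%N -> 0 <= A j) /\
  forall p : {poly R}, (size p <= (2 * r).+1)%N ->
    p.[1] - p.[-1] = \sum_(1 <= j < r.+1) A j * p^`().[G j].
Proof.
(* qpoly's Lagrange basis wants sampling points injective on all of nat *)
pose X (k : nat) : R := if (k < r)%N then G k.+1 else k.+2%:R.
have Xinj : injective X.
  have Xlt j k : (j < k)%N -> X j < X k.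
    rewrite /X => jk; case: ltnP => jr; case: ltnP => kr; first exact: legendre_zeros_lt.
    - have /legendre_zeros_itv/andP[_ H] : (1 <= j.+1 <= r)%N by lia.
      by apply: (lt_trans H); rewrite ltr1n.
    - lia.
    - by rewrite ltr_nat.
  move=> j k E; case: (ltngtP j k) => // /Xlt; by rewrite E ltxx.
pose l (i : 'I_r) : {poly R} := tnth (qpoly.lagrange r X) i.
have sl i : size (l i) = r by exact: qpoly.size_lagrange_.
have lX (i j : 'I_r) : (l i).[G j.+1] = (i == j)%:R.
  have := qpoly.lagrange_sample r0 Xinj i j.
  by rewrite /X ltn_ord => <-.
(* Divide by the Legendre polynomial: the multiple integrates to 0 by orthogonality, and the
   remainder, of degree below r, equals its Lagrange interpolant and agrees with [p] at the
   zeros. *)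
have E (p : {poly R}) : (size p <= 2 * r)%N ->
    ref_int p = \sum_(i < r) ref_int (l i) * p.[G i.+1].
  move=> sp; rewrite (divp_eq p (legendre R r)) linearD /= mulrC.
  rewrite ref_int_legendre_mul ?add0r; last first.
    by rewrite size_divp ?legendre_neq0 // size_legendre_zeros leq_subLR addnn -mul2n.
  rewrite {1}[p %% _](qpoly.lagrange_gen r0 Xinj); last first.
    by have := ltn_modpN0 p legendre_neq0; rewrite size_legendre_zeros.
  rewrite linear_sum; apply: eq_bigr => i _ /=.
  rewrite mul_polyC linearZ /= mulrC /X ltn_ord; congr (_ * _).
  rewrite hornerD hornerM.
  have /rootP -> : root (legendre R r) (G i.+1).
    by apply: legendre_zeros_root; have := ltn_ord i; lia.
  by rewrite mul0r add0r.
(* The sum has at most one term; it only re-indexes the weights from ['I_r] to 1, ..., r. *)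
exists (fun j => \sum_(i < r | i.+1 == j) ref_int (l i)).
split=> [j jr|p sp].
  apply: sumr_ge0 => i _.
  (* [l i] and its square agree at all the zeros, and the square has degree 2r - 2, so the rule is
     exact for it too; a weight is thus the integral of a square. *)
  have -> : ref_int (l i) = ref_int (l i ^+ 2).
    rewrite [RHS]E; last first.
      by apply: (leq_trans (size_poly_exp_leq _ _)); rewrite sl; lia.
    rewrite (bigD1 i) //= big1 ?addr0 => [|k ki].
      by rewrite horner_exp lX eqxx expr1n mulr1.
    by rewrite horner_exp lX eq_sym (negPf ki) expr0n mulr0.
  by apply: ref_int_ge0 => t; rewrite horner_exp sqr_ge0.
rewrite -ref_int_deriv E; last first.
  have [->|p0] := eqVneq p 0; first by rewrite raddf0 size_poly0.
  by have := lt_size_deriv p0; lia.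
rewrite big_add1 /= big_mkord; apply: eq_bigr => j _.
by congr (_ * _); rewrite (big_pred1 j) // => i /=; rewrite eqSS.
Qed.

End Quadrature.

(** * The du Bois-Reymond lemma *)

(** A quadratic remainder bound lets piecewise quadratic functions be differentiated at their break
    points like anywhere else. *)
Lemma is_derive_quadratic (R : realType) (f : R -> R) (t d K : R) :
  (forall h, `|f (t + h) - f t - d * h| <= K * h ^+ 2) -> is_derive t 1 f d.
Proof.
move=> fK.
have fd : h^-1 *: ((f \o shift t) (h *: 1) - f t) @[h --> 0^'] --> d.
  apply/cvgrPdist_le => e e0; near=> h.
  have h0 : h != 0 by near: h; exact: nbhs_dnbhs_neq.
  (* [|K| + 1] is a positive divisor whatever the sign of [K]. *)
  have hK : `|h| <= e / (`|K| + 1).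
    near: h; apply: dnbhs0_le; rewrite divr_gt0 // ltr_wpDl //.
  rewrite /= /GRing.scale /= mulr1 addrC [h + t]addrC.
  have -> : - (h^-1 * (f (t + h) - f t)) + d =
            - h^-1 * (f (t + h) - f t - d * h) by field.
  rewrite normrM normrN normfV ler_pdivrMl ?normr_gt0 //.
  apply: (le_trans (fK h)); rewrite -real_normK ?num_real // expr2.
  rewrite mulrA [leLHS]mulrC ler_pM2l ?normr_gt0 //.
  move: hK; rewrite ler_pdivlMr ?ltr_wpDl // => hK.
  have := ler_norm K; have := normr_ge0 h; nra.
apply: DeriveDef; first by apply/cvg_ex; exists d.
by apply/cvg_lim => //; exact: Rhausdorff.
Unshelve. all: by end_near. Qed.

(** * A C^1 step function and its rescalings *)

Section Bump.
Variable R : realType.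

Let pos (t : R) : R := Num.max t 0.

(* Second difference of the C^1 function max(t, 0)^2, hence a C^1 step from 0
   to 2. *)
Definition step (t : R) : R := pos t ^+ 2 - 2 * pos (t - 1) ^+ 2 + pos (t - 2) ^+ 2.
(** Twice the hat function on [0, 2] with peak 1 at 1, hence of integral 2. *)
Definition step_deriv (t : R) : R := 2 * (pos t - 2 * pos (t - 1) + pos (t - 2)).

Let posE (t : R) : (t <= 0 /\ pos t = 0) \/ (0 <= t /\ pos t = t).
Proof. by rewrite /pos; case: (leP t 0) => h; [left|right]; split => //; exact: ltW. Qed.

Let pos_quadratic (t h : R) : `|pos (t + h) ^+ 2 - pos t ^+ 2 - 2 * pos t * h| <= h ^+ 2.
Proof.
rewrite ler_norml; apply/andP.
by case: (posE t) => -[? ->]; case: (posE (t + h)) => -[? ->]; split; nra.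
Qed.

(** The constant 4 is 1 + 2 + 1, from the coefficients of the second difference. *)
Lemma step_quadratic (t h : R) :
  `|step (t + h) - step t - step_deriv t * h| <= 4 * h ^+ 2.
Proof.
have := pos_quadratic t h; have := pos_quadratic (t - 1) h.
have := pos_quadratic (t - 2) h; rewrite /step /step_deriv !(addrAC _ _ h) !ler_norml.
by move=> /andP[? ?] /andP[? ?] /andP[? ?]; apply/andP; split; lra.
Qed.

Lemma step_le0 (t : R) : t <= 0 -> step t = 0.
Proof.
by move=> ?; rewrite /step; case: (posE t) => -[? ->]; case: (posE (t - 1)) => -[? ->];
  case: (posE (t - 2)) => -[? ->]; nra.
Qed.

Lemma step_ge2 (t : R) : 2 <= t -> step t = 2.
Proof.
by move=> ?; rewrite /step; case: (posE t) => -[? ->]; case: (posE (t - 1)) => -[? ->];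
  case: (posE (t - 2)) => -[? ->]; nra.
Qed.

Lemma step_itv (t : R) : 0 <= step t <= 2.
Proof.
apply/andP; rewrite /step; case: (posE t) => -[? ->]; case: (posE (t - 1)) => -[? ->];
  case: (posE (t - 2)) => -[? ->]; split; nra.
Qed.

Lemma step_deriv_itv (t : R) : 0 <= step_deriv t <= 2.
Proof.
apply/andP; rewrite /step_deriv; case: (posE t) => -[? ->]; case: (posE (t - 1)) => -[? ->];
  case: (posE (t - 2)) => -[? ->]; split; lra.
Qed.

Lemma step_deriv_out (t : R) : t <= 0 \/ 2 <= t -> step_deriv t = 0.
Proof.
by rewrite /step_deriv; case: (posE t) => -[? ->]; case: (posE (t - 1)) => -[? ->];
  case: (posE (t - 2)) => -[? ->]; case=> ?; lra.
Qed.

Lemma continuous_step_deriv : continuous step_deriv.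
Proof.
have cpos (c : R) : continuous (fun t => pos (t - c)).
  move=> t; apply: (@continuous_max _ _ (fun t => t - c) (cst 0)).
    by apply: cvgB => //; exact: cvg_cst.
  exact: cvg_cst.
move=> t; apply: cvgM; first exact: cvg_cst.
apply: cvgD; last exact: cpos.
apply: cvgB; last by apply: cvgM; [exact: cvg_cst|exact: cpos].
by have := cpos 0 t; rewrite /continuous_at subr0; under eq_fun do rewrite subr0.
Qed.

(** For n > 0 the rise takes place on [s, s + 2 / n]; the derivative is a one-sided approximate
    identity at [s], of mass 2. *)
Definition rstep (n s t : R) : R := step (n * (t - s)).
Definition rstep_deriv (n s t : R) : R := n * step_deriv (n * (t - s)).

Lemma is_derive_rstep (n s t : R) : is_derive t 1 (rstep n s) (rstep_deriv n s t).
Proof.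
apply: (@is_derive_quadratic _ _ _ _ (4 * n ^+ 2)) => h; rewrite /rstep /rstep_deriv.
have -> : n * (t + h - s) = n * (t - s) + n * h by ring.
have -> : n * step_deriv (n * (t - s)) * h = step_deriv (n * (t - s)) * (n * h) by ring.
by rewrite -mulrA -exprMn; exact: step_quadratic.
Qed.

Lemma continuous_rstep_deriv (n s : R) : continuous (rstep_deriv n s).
Proof.
move=> t; apply: cvgM; first exact: cvg_cst.
apply: (@continuous_comp _ _ _ (fun t => n * (t - s)) step_deriv).
  by apply: cvgM; [exact: cvg_cst|apply: cvgB => //; exact: cvg_cst].
exact: continuous_step_deriv.
Qed.

End Bump.

(** * Integrability, and concentration at Lebesgue points *)

Lemma lebesgue_measure_itv_lty (R : realType) (a b : bool) (x y : R) :
  ((@lebesgue_measure R) [set` Interval (BSide a x) (BSide b y)] < +oo)%E.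
Proof. by rewrite lebesgue_measure_itv /=; case: ifP => _; rewrite ltry. Qed.

Lemma integrable_mul_bounded (R : realType) (D : set R) (v h : R -> R) (K : R) :
  measurable D -> lebesgue_measure.-integrable D (EFin \o v) ->
  measurable_fun D h -> (forall t, `|h t| <= K) ->
  lebesgue_measure.-integrable D (EFin \o (fun t => v t * h t)).
Proof.
move=> mD iv mh hK.
have -> : EFin \o (fun t => v t * h t) = ((EFin \o v) \* (EFin \o h))%E.
  by apply/funext => t /=; rewrite EFinM.
apply: integrableMl => //; exists K; split; first exact: num_real.
by move=> y Ky t _; exact: le_trans (hK t) (ltW Ky).
Qed.

Lemma integrable_cst_itvoo (R : realType) (x y c : R) :
  (@lebesgue_measure R).-integrable `]x, y[ (EFin \o cst c).
Proof.
apply: measurable_bounded_integrable => //.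
  exact: lebesgue_measure_itv_lty.
by exists `|c|; split; [exact: num_real|move=> z cz t _; exact: ltW].
Qed.

Lemma measurable_rstep_deriv (R : realType) (n s : R) (D : set R) :
  measurable_fun D (rstep_deriv n s).
Proof.
apply: measurable_funTS; apply: continuous_measurable_fun.
exact: continuous_rstep_deriv.
Qed.

Lemma rstep_deriv_bound (R : realType) (n s t : R) :
  0 <= n -> `|rstep_deriv n s t| <= n * 2.
Proof.
move=> n0; have /andP[h0 h2] := step_deriv_itv (n * (t - s)).
by rewrite ger0_norm /rstep_deriv; nra.
Qed.

(** Fundamental theorem of calculus: [2 <= n * (y - s)] ensures that [rstep] has reached its final
    value 2 at [y]. *)
Lemma Rintegral_rstep_deriv (R : realType) (x y s n : R) :
  x < s -> s < y -> 0 < n -> 2 <= n * (y - s) ->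
  \int[lebesgue_measure]_(t in `]x, y[) rstep_deriv n s t = 2.
Proof.
move=> xs sy n0 ns.
have mr D : measurable_fun D (rstep_deriv n s) by exact: measurable_rstep_deriv.
have ir (a b : bool) : lebesgue_measure.-integrable
    [set` Interval (BSide a x) (BSide b y)] (EFin \o rstep_deriv n s).
  apply: measurable_bounded_integrable => //.
  - exact: lebesgue_measure_itv_lty.
  - exact: mr.
  exists (n * 2); split; first exact: num_real.
  by move=> z nz t _; apply: le_trans (rstep_deriv_bound _ _ (ltW n0)) (ltW nz).
rewrite Rintegral_itv_bndo_bndc ?Rintegral_itv_obnd_cbnd; [|exact: ir..].
rewrite /Rintegral (@continuous_FTC2 _ _ (rstep n s)).
- by rewrite /= /rstep step_ge2 // step_le0 ?subr0 // nmulr_lle0 ?subr_lt0 // ltW.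
- exact: lt_trans xs sy.
- by apply: continuous_subspaceT => t; exact: continuous_rstep_deriv.
- have cr : continuous (rstep n s).
    move=> t; apply/differentiable_continuous/derivable1_diffP.
    by have [] := is_derive_rstep n s t.
  split; first by move=> t _; have [] := is_derive_rstep n s t.
    exact/cvg_at_right_filter/cr.
  exact/cvg_at_left_filter/cr.
- by move=> t _; rewrite derive1E; have [_ ->] := is_derive_rstep n s t.
Qed.

(** The kernel has mass 2, is at most 2n and is supported near [s], so the error is controlled by
    the mean of |v - v s| on a small ball, which tends to 0 at a Lebesgue point. *)
Lemma cvg_rstep_lebesgue_pt (R : realType) (x y s : R) (v : R -> R) :
  x < s -> s < y ->
  lebesgue_measure.-integrable `]x, y[ (EFin \o v) ->
  lebesgue_pt (v \_ `]x, y[) s ->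
  (fun n => \int[lebesgue_measure]_(t in `]x, y[) (v t * rstep_deriv n%:R s t))
    @ \oo --> 2 * v s.
Proof.
move=> xs sy iv ls; set I := `]x, y[%classic.
have mI : measurable I by exact: measurable_itv.
have sI : s \in I by rewrite inE /I /= in_itv /= xs sy.
have v0s : (v \_ I) s = v s by rewrite patchE sI.
apply/cvgrPdist_le => e e0.
(* 12 = (2n)(6 / n): the bound on the kernel times the length of the ball of radius 3 / n, which
   contains the support [s, s + 2 / n]. *)
have e12 : 0 < e / 12 by rewrite divr_gt0.
have /= := ls _ (open_ereal_lt' _).
move=> /(_ (e / 12)%:E); rewrite lte_fin => /(_ e12)[d /= d0 Hd].
near=> n.
have n0 : 0 < n%:R :> R by near: n; exact: nbhs_infty_gtr.
have nd : 3 / d < n%:R by near: n; exact: nbhs_infty_gtr.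
have ny : 2 / (y - s) <= n%:R by near: n; exact: nbhs_infty_ger.
pose rd := rstep_deriv n%:R s.
have mrd D : measurable_fun D rd by exact: measurable_rstep_deriv.
have rdK t : `|rd t| <= n%:R * 2 by exact/rstep_deriv_bound/ltW.
have r0 : 0 < 3 / n%:R :> R by rewrite divr_gt0.
have /Hd : `|0 - 3 / n%:R| < d.
  rewrite sub0r normrN gtr0_norm // ltr_pdivrMr // mulrC.
  by rewrite -ltr_pdivrMr.
move=> /(_ r0); set rho : R := 3 / n%:R => davge.
have iw : lebesgue_measure.-integrable I (EFin \o (fun t => v t - v s)).
  have -> : EFin \o (fun t => v t - v s) = ((EFin \o v) \- (EFin \o cst (v s)))%E by [].
  by apply: integrableB => //; exact: integrable_cst_itvoo.
have iwrd : lebesgue_measure.-integrable I (EFin \o (fun t => (v t - v s) * rd t)).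
  exact: integrable_mul_bounded rdK.
(* Since the kernel has mass 2, the limit 2 v(s) can be split off exactly. *)
have -> : \int[lebesgue_measure]_(t in I) (v t * rd t) =
    \int[lebesgue_measure]_(t in I) ((v t - v s) * rd t) + v s * 2.
  rewrite -(@Rintegral_rstep_deriv _ x y s n%:R) //; last first.
    by rewrite -ler_pdivrMr ?subr_gt0.
  rewrite -RintegralZl //; last first.
    have := @integrable_mul_bounded _ I (cst 1) rd _ mI (integrable_cst_itvoo x y 1) (mrd _) rdK.
    by apply: eq_integrable => // t _ /=; rewrite mul1r.
  rewrite -RintegralD //; last first.
    exact: (@integrable_mul_bounded _ I (cst (v s)) rd _ mI (integrable_cst_itvoo x y _) (mrd _) rdK).
  by apply: eq_Rintegral => t _; rewrite /rd; ring.
rewrite mulrC opprD addrCA subrr addr0 normrN -lee_fin.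
apply: (@le_trans _ _ (12 * (e / 12))%:E); last by rewrite lee_fin; lra.
apply: (@le_trans _ _ (12%:E * davg (v \_ I) s rho)%E); last first.
  by rewrite EFinM lee_pmul2l //; exact: ltW.
rewrite EFin_normr_Rintegral //.
apply: (le_trans (le_abse_integral _ _ _)) => //; first by case/integrableP: iwrd.
pose kr t : R := `|(center ((v \_ I) s) \o (v \_ I)) t|.
pose k : R -> \bar R := EFin \o kr.
have mk : measurable_fun setT (EFin \o kr).
  apply/measurable_EFinP; apply: measurableT_comp => //.
  apply: measurable_funB => //; apply/(measurable_restrictT _ mI).
  by case/integrableP : iv => /measurable_EFinP.
have kr0 t : 0 <= kr t by exact: normr_ge0.
have k0 t : (0 <= k t)%E by rewrite lee_fin.
pose h : R -> \bar R := EFin \o (fun t => n%:R * 2 * kr t).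
have mh : measurable_fun setT (EFin \o (fun t => n%:R * 2 * kr t)).
  by apply/measurable_EFinP; apply: measurable_funM => //; apply/measurable_EFinP.
have h0 t : (0 <= h t)%E by rewrite lee_fin !mulr_ge0 // ltW.
have mB : measurable (ball s rho) by exact: measurable_ball.
(* Off the ball the kernel vanishes; on it, it is at most 2n. *)
apply: (@le_trans _ _ (\int[lebesgue_measure]_(t in I) ((h \_ (ball s rho)) t))%E).
  apply: ge0_le_integral => //.
  - by apply/measurable_EFinP; apply: measurableT_comp => //; case/integrableP: iwrd => /measurable_EFinP.
  - by apply: measurable_funTS; apply/(measurable_restrictT _ mB); exact: measurable_funTS.
  move=> t It; rewrite patchE; case: ifPn => [tB|tB].
    rewrite /h /kr /= v0s patchE mem_set // lee_fin normrM mulrC.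
    by apply: ler_wpM2r.
  have -> : rd t = 0; last by rewrite mulr0 abse0; exact: lexx.
  rewrite /rd /rstep_deriv step_deriv_out ?mulr0 //.
  have : rho <= `|s - t| by move: tB; rewrite notin_setE /ball /= => /negP; rewrite -leNgt.
  rewrite /rho ler_pdivrMr // => H.
  case: (leP t s) H => ts; [rewrite ger0_norm ?subr_ge0 // => H; left|rewrite ltr0_norm ?subr_lt0 // => H; right]; nra.
rewrite -integral_mkcondr; apply: (@le_trans _ _ (\int[lebesgue_measure]_(t in ball s rho) h t)%E).
  apply: ge0_subset_integral => //; [exact: measurableI|exact: measurable_funTS].
rewrite (_ : h = fun t => ((n%:R * 2)%:E * k t)%E) //.
rewrite ge0_integralZl //; last exact: measurable_funTS.
rewrite /davg /iavg lebesgue_measure_ball ?(ltW r0) // inver mulrn_eq0 /= gt_eqF //.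
rewrite muleA -EFinM (_ : 12 * _ = n%:R * 2) // /rho -mulr_natr; field.
by rewrite gt_eqF.
Unshelve. all: by end_near. Qed.

(** * Increments of a function with an integrable weak derivative *)

Section DuBoisReymond.
Variables (R : realType) (x y : R) (v g : R -> R).
Hypotheses (iv : lebesgue_measure.-integrable `]x, y[ (EFin \o v))
  (ig : lebesgue_measure.-integrable `]x, y[ (EFin \o g))
  (wd : weak_deriv x y v g).

Let phi (s s' : R) (n : nat) (t : R) : R := rstep n%:R s t - rstep n%:R s' t.

Let phi_derive (s s' t : R) (n : nat) :
  is_derive t 1 (phi s s' n) (rstep_deriv n%:R s t - rstep_deriv n%:R s' t).
Proof. by apply: is_deriveB; exact: is_derive_rstep. Qed.

Let derive1_phi (s s' : R) (n : nat) :
  derive1 (phi s s' n) = (fun t => rstep_deriv n%:R s t - rstep_deriv n%:R s' t).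
Proof.
by apply/funext => t; rewrite derive1E; have [_ ->] := phi_derive s s' t n.
Qed.

(** Both steps are 0 before [s], and both are 2 and cancel after s' + 2 / n, which is below [y] by
    the condition on [n]. *)
Let phi_C1c (s s' : R) (n : nat) : x < s -> s < s' -> s' < y ->
  2 / (y - s') < n%:R -> C1c x y (phi s s' n).
Proof.
move=> xs ss' s'y ny.
have n0 : 0 < n%:R :> R by apply: lt_trans ny; rewrite divr_gt0 ?subr_gt0.
have n2 : n%:R * (2 / n%:R) = 2 :> R by field; rewrite gt_eqF.
have n20 : 0 < 2 / n%:R :> R by rewrite divr_gt0.
split.
- by move=> t; have [] := phi_derive s s' t n.
- rewrite derive1_phi => t.
  by apply: cvgB; exact: continuous_rstep_deriv.
exists s, (s' + 2 / n%:R); split => //.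
  move: ny; rewrite ltr_pdivrMr ?subr_gt0 // => ny.
  by rewrite -ltrBrDl ltr_pdivrMr // mulrC.
move=> t; rewrite in_itv /= negb_and -!ltNge => /orP[ts|ts].
  by rewrite /phi /rstep !step_le0 ?subr0 //; nra.
by rewrite /phi /rstep !step_ge2 ?subrr //; nra.
Qed.

Let phi_itv (s s' t : R) (n : nat) : `|phi s s' n t| <= 2.
Proof.
have /andP[? ?] := step_itv (n%:R * (t - s)).
have /andP[? ?] := step_itv (n%:R * (t - s')).
by rewrite /phi /rstep ler_norml; apply/andP; split; lra.
Qed.

(** At a fixed point each step is eventually constant. It is still 0 at its own starting point,
    hence the half-open interval. *)
Let phi_cvg (s s' t : R) : s < s' ->
  \forall n \near \oo, phi s s' n t = 2 * \1_(`]s, s']) t.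
Proof.
move=> ss'; have st (c : R) : \forall n \near \oo, rstep n%:R c t = if c < t then 2 else 0.
  case: ltP => [ct|tc]; last first.
    by near=> n; rewrite /rstep step_le0 // mulr_ge0_le0 // subr_le0.
  near=> n; rewrite /rstep step_ge2 // -ler_pdivrMr ?subr_gt0 //.
  by near: n; exact: nbhs_infty_ger.
near=> n; rewrite /phi.
rewrite (_ : rstep n%:R s t = if s < t then 2 else 0); last by near: n; exact: st.
rewrite (_ : rstep n%:R s' t = if s' < t then 2 else 0); last by near: n; exact: st.
rewrite indicE mem_setE in_itv /=.
case: (ltP s t) => h1; case: (ltP s' t) => h2 /=; rewrite ?subrr ?subr0 ?mulr0 ?mulr1 //.
by have := lt_le_trans (lt_trans ss' h2) h1; rewrite ltxx.
Unshelve. all: by end_near. Qed.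

(** Dominated convergence, with dominating function 2 |g|. *)
Let cvg_Rintegral_phi (s s' : R) : x < s -> s < s' -> s' < y ->
  (fun n => \int[lebesgue_measure]_(t in `]x, y[) (g t * phi s s' n t)) @ \oo -->
  2 * \int[lebesgue_measure]_(t in `]s, s']) g t.
Proof.
move=> xs ss' s'y.
have mI : measurable (`]x, y[%classic : set R) by exact: measurable_itv.
have mP : measurable (`]s, s']%classic : set R) by exact: measurable_itv.
have mg : measurable_fun `]x, y[ g by case/integrableP: ig => /measurable_EFinP.
have mphi n D : measurable_fun D (phi s s' n).
  apply: measurable_funTS; apply: continuous_measurable_fun => t.
  by apply/differentiable_continuous/derivable1_diffP; have [] := phi_derive s s' t n.
pose l t := g t * (2 * \1_(`]s, s']) t).
have ml : measurable_fun `]x, y[ l.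
  by apply: measurable_funM => //; apply: measurable_funM => //; exact: measurable_indic.
have il : lebesgue_measure.-integrable `]x, y[ (EFin \o l).
  apply: (@integrable_mul_bounded _ _ g (fun t => 2 * \1_(`]s, s']) t) 2) => //.
    by apply: measurable_funM => //; exact: measurable_indic.
  by move=> t; rewrite indicE; case: (_ \in _); rewrite ?mulr1 ?mulr0 ?normr0 ?ger0_norm.
have i2 : lebesgue_measure.-integrable `]x, y[ (EFin \o (fun t => `|g t| * 2)).
  apply: (@integrable_mul_bounded _ _ _ (cst 2) 2) => //; first exact: integrable_norm ig.
  by move=> t; rewrite ger0_norm.
have [|||||_ _ H] := @dominated_convergence _ _ R lebesgue_measure `]x, y[ mI
  (fun n => EFin \o (fun t => g t * phi s s' n t)) (EFin \o l)
  (EFin \o (fun t => `|g t| * 2)).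
- by move=> n; apply/measurable_EFinP; apply: measurable_funM => //; exact: mphi.
- exact/measurable_EFinP.
- apply: aeW => t _; apply: cvg_near_cst; near=> n => /=.
  by rewrite /l; congr (_ * _)%:E; near: n; exact: phi_cvg.
- exact: i2.
- apply: aeW => t n _ /=; rewrite lee_fin normrM; exact: ler_wpM2l.
have -> : 2 * \int[lebesgue_measure]_(t in `]s, s']) g t =
    \int[lebesgue_measure]_(t in `]x, y[) l t.
  have PI : `]s, s'] `<=` `]x, y[.
    move=> t /=; rewrite !in_itv /= => /andP[st ts'].
    by rewrite (lt_trans xs st) (le_lt_trans ts' s'y).
  rewrite -RintegralZl //; last exact: integrableS ig.
  rewrite -(setIidr PI) Rintegral_mkcondr; apply: eq_Rintegral => t _.
  by rewrite patchE /l indicE; case: ifPn => _ ; rewrite ?mulr1 ?mulr0 // mulrC.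
apply: fine_cvg; rewrite fineK //; exact: integrable_fin_num.
Unshelve. all: by end_near. Qed.

(* As n grows, [phi s s' n] tends to twice the indicator of ]s, s'] while its
   derivative concentrates at s and s'. *)
Lemma weak_deriv_lebesgue_pt (s s' : R) : x < s -> s < s' -> s' < y ->
  lebesgue_pt (v \_ `]x, y[) s -> lebesgue_pt (v \_ `]x, y[) s' ->
  v s' - v s = \int[lebesgue_measure]_(t in `]s, s']) g t.
Proof.
move=> xs ss' s'y ls ls'.
have sy := lt_trans ss' s'y; have xs' := lt_trans xs ss'.
have mI : measurable (`]x, y[%classic : set R) by exact: measurable_itv.
have H1 := cvgB (cvg_rstep_lebesgue_pt xs sy iv ls) (cvg_rstep_lebesgue_pt xs' s'y iv ls').
have H2 := cvgN (cvg_Rintegral_phi xs ss' s'y).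
suff : 2 * v s - 2 * v s' = - (2 * \int[lebesgue_measure]_(t in `]s, s']) g t) by lra.
apply: (cvg_unique (@Rhausdorff R) (H1 _)); apply: cvg_trans (H2 _); apply: near_eq_cvg; near=> n => /=.
have n0 : 0 <= n%:R :> R by [].
have := wd (phi_C1c xs ss' s'y _) => /(_ n).
rewrite !fctE derive1_phi => <-; last by near: n; exact: nbhs_infty_gtr.
have ird c : lebesgue_measure.-integrable `]x, y[ (EFin \o (fun t => v t * rstep_deriv n%:R c t)).
  apply: integrable_mul_bounded => //; first exact: measurable_rstep_deriv.
  by move=> t; exact: rstep_deriv_bound.
by rewrite -RintegralB //; apply: eq_Rintegral => t _; rewrite mulrBr.
Unshelve. all: by end_near. Qed.

(** Almost every point is a Lebesgue point; one of them, [s0], fixes the constant, and the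
    increments from it give all other values. *)
Lemma weak_deriv_ae : exists c : R, {ae lebesgue_measure, forall t,
  t \in `]x, y[ -> v t = c + \int[lebesgue_measure]_(z in `]x, t]) g z}.
Proof.
have mI : measurable (`]x, y[%classic : set R) by exact: measurable_itv.
have aeL := lebesgue_differentiation (integrable_locally_restrict mI iv).
(* If the interval contains no Lebesgue point, for instance when it is empty, the identity is
   vacuous off a null set and any constant will do. *)
have [[s0 s0I ls0]|noL] :=
  pselect (exists2 s0, (s0 \in `]x, y[) & lebesgue_pt (v \_ `]x, y[) s0); last first.
  exists 0; apply: filterS aeL; first exact: (ae_filter_ringOfSetsType lebesgue_measure).
  by move=> t lt tI; exfalso; apply: noL; exists t.
exists (v s0 - \int[lebesgue_measure]_(z in `]x, s0]) g z).
move: s0I; rewrite in_itv /= => /andP[xs0 s0y].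
have split_int s s' : x < s -> s <= s' -> s' < y ->
    \int[lebesgue_measure]_(z in `]x, s']) g z - \int[lebesgue_measure]_(z in `]x, s]) g z
    = \int[lebesgue_measure]_(z in `]s, s']) g z.
  move=> xs ss' s'y; apply: Rintegral_itvB.
  - apply: integrableS ig => //.
    by move=> t /=; rewrite !in_itv /= => /andP[-> ts']; exact: le_lt_trans ts' s'y.
  - by rewrite bnd_simp ltW.
  - by rewrite bnd_simp.
apply: filterS aeL; first exact: (ae_filter_ringOfSetsType lebesgue_measure).
move=> t lt; rewrite in_itv /= => /andP[xt ty].
case: (ltgtP s0 t) => [st|ts|<-]; last by lra.
  have := weak_deriv_lebesgue_pt xs0 st ty ls0 lt.
  by rewrite -split_int // ?(ltW st) //; lra.
have := weak_deriv_lebesgue_pt xt ts s0y lt ls0.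
by rewrite -split_int // ?(ltW ts) //; lra.
Qed.

End DuBoisReymond.

(** * Taylor approximation from weak derivatives *)

Lemma Linf_norm_ge0 (R : realType) (x y : R) (g : R -> R) : (0 <= Linf_norm x y g)%E.
Proof. exact: Lnorm_ge0. Qed.

Lemma Linf_norm_ae (R : realType) (x y M : R) (g : R -> R) : x < y ->
  (Linf_norm x y g <= M%:E)%E ->
  {ae lebesgue_measure, forall t, t \in `]x, y[ -> `|g t| <= M}.
Proof.
move=> xy; rewrite /Linf_norm unlock /= ifT; last first.
  by rewrite /mrestr setTI lebesgue_measure_itv /= lte_fin xy -EFinD lte_fin subr_gt0.
move=> /ess_supP[A [mA A0 bA]].
(* [A] is null for the restricted measure only; its part in the interval is null for Lebesgue
   measure. *)
exists (A `&` `]x, y[); split; [exact: measurableI|exact: A0|].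
move=> t /= H; split.
  by apply: bA => /= Ht; apply: H => _; move: Ht; rewrite lee_fin.
by move: H; rewrite not_implyE => -[].
Qed.

Lemma Linf_integrable (R : realType) (x y : R) (g : R -> R) : x < y ->
  Linf x y g -> lebesgue_measure.-integrable `]x, y[ (EFin \o g).
Proof.
move=> xy [mg gfin].
have mI : measurable (`]x, y[%classic : set R) by exact: measurable_itv.
have := Linf_norm_ge0 x y g; case E : (Linf_norm x y g) gfin => [M| |] // _ M0.
apply/integrableP; split; first exact/measurable_EFinP.
apply: (@le_lt_trans _ _ (\int[lebesgue_measure]_(t in `]x, y[) (cst M%:E) t)%E); last first.
  rewrite integral_cst //; apply: lte_mul_pinfty => //; exact: lebesgue_measure_itv_lty.
apply: ae_ge0_le_integral => //.
- by apply: measurableT_comp => //; exact/measurable_EFinP.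
- apply: filterS (@Linf_norm_ae _ x y M g xy _); last by rewrite E.
    exact: (ae_filter_ringOfSetsType lebesgue_measure).
  by move=> t H tI /=; rewrite lee_fin; exact: H.
Qed.

(** A difference at one point would persist on an open interval of positive length inside the
    exceptional null set. *)
Lemma ae_eq_within_continuous (R : realType) (x y : R) (F G : R -> R) :
  {within `[x, y], continuous F} -> {within `[x, y], continuous G} -> x < y ->
  {ae lebesgue_measure, forall t, t \in `]x, y[ -> F t = G t} ->
  forall t, t \in `[x, y] -> F t = G t.
Proof.
move=> cF cG xy [A [mA A0 bA]] t txy; apply/eqP; rewrite -subr_eq0.
apply/negPn/negP => FG.
have /(_ t txy) := (subspace_continuousP _ _).1 cF.
have /(_ t txy) := (subspace_continuousP _ _).1 cG.
move=> ctG ctF.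
have := cvgB ctF ctG => /(_ _).
move/cvgrPdist_lt => /(_ `|F t - G t|); rewrite normr_gt0 => /(_ FG).
rewrite near_withinE => -[d /= d0 Hd].
(* The part of the ball inside the interval; it is non-empty even when [t] is an end point. *)
pose lo := Num.max x (t - d); pose hi := Num.min y (t + d).
move: txy; rewrite in_itv /= => /andP[xt ty].
have lohi : lo < hi.
  rewrite /lo /hi lt_min !gt_max xy /=; apply/and3P; split; lra.
have sub : `]lo, hi[ `<=` A.
  move=> z /=; rewrite in_itv /= /lo /hi lt_min gt_max => /andP[/andP[xz zl] /andP[zy zh]].
  apply: bA => /= /(_ _); rewrite in_itv /= xz zy => /(_ isT) E.
  have : ball t d z by rewrite /ball /= ltr_distlC zl zh.
  move=> /Hd /=; rewrite in_itv /= (ltW xz) (ltW zy) => /(_ isT).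
  by rewrite [X in _ - X](_ : _ = F z - G z) // E subrr subr0 ltxx.
have : (lebesgue_measure (`]lo, hi[%classic : set R) <= lebesgue_measure A)%E.
  by apply: le_measure => //; rewrite inE.
by rewrite A0 lebesgue_measure_itv /= lte_fin lohi -EFinD lee_fin subr_le0 leNgt lohi.
Qed.

(** Integrals ignore null sets, so the weak derivative may be replaced by a better representative
    [G]: bounded everywhere, or continuous. *)
Lemma weak_deriv_ae_integral (R : realType) (x y : R) (v v1 G : R -> R) : x < y ->
  lebesgue_measure.-integrable `]x, y[ (EFin \o v) ->
  lebesgue_measure.-integrable `]x, y[ (EFin \o v1) ->
  weak_deriv x y v v1 ->
  lebesgue_measure.-integrable `[x, y] (EFin \o G) ->
  {ae lebesgue_measure, forall t, t \in `]x, y[ -> v1 t = G t} ->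
  exists c, {ae lebesgue_measure, forall t, t \in `]x, y[ ->
    v t = c + \int[lebesgue_measure]_(z in `[x, t]) G z}.
Proof.
move=> xy iv iv1 wd iG v1G; have [c Hc] := weak_deriv_ae iv iv1 wd.
exists c; apply: filterS Hc; first exact: (ae_filter_ringOfSetsType lebesgue_measure).
move=> t H txy; rewrite H //; congr (_ + _).
move: txy; rewrite in_itv /= => /andP[xt ty].
have sub : `]x, t] `<=` `]x, y[.
  by move=> z /=; rewrite !in_itv /= => /andP[-> zt]; exact: le_lt_trans zt ty.
have sub' : `]x, t] `<=` `[x, y].
  move=> z /=; rewrite !in_itv /= => /andP[xz zt]; rewrite (ltW xz) /=.
  by apply: le_trans zt (ltW ty).
have mJ : measurable (`]x, t]%classic : set R) by exact: measurable_itv.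
have iv1' : lebesgue_measure.-integrable `]x, t] (EFin \o v1) by exact: integrableS iv1.
have iG' : lebesgue_measure.-integrable `]x, t] (EFin \o G) by exact: integrableS iG.
rewrite -Rintegral_itv_obnd_cbnd // /Rintegral; congr fine.
apply: ae_eq_integral => //.
- by case/integrableP: iv1'.
- by case/integrableP: iG'.
- apply: filterS v1G; first exact: (ae_filter_ringOfSetsType lebesgue_measure).
  by move=> z Hz /sub zI /=; rewrite Hz.
Qed.

(* Nothing is said on the derivative when k = 0: F is then only Lipschitz. *)
Lemma weak_derivn_taylor (R : realType) (x y M : R) (k : nat) (v g : R -> R) :
  x < y -> 0 <= M -> weak_derivn x y k.+1 v g ->
  {ae lebesgue_measure, forall t, t \in `]x, y[ -> `|g t| <= M} ->
  exists (F : R -> R) (p : {poly R}),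
    [/\ {within `[x, y], continuous F}, (size p <= k.+1)%N,
        {ae lebesgue_measure, forall t, t \in `]x, y[ -> v t = F t},
        forall t, t \in `[x, y] -> `|F t - p.[t]| <= M * (y - x) ^+ k.+1 &
        (0 < k)%N -> forall t, t \in `]x, y[ -> derivable F t 1 /\
          `|derive1 F t - p^`().[t]| <= M * (y - x) ^+ k].
Proof.
move=> xy M0; have y_x0 : 0 <= y - x by rewrite subr_ge0 ltW.
have aeF := ae_filter_ringOfSetsType (@lebesgue_measure R).
(* Each further order integrates the representative and the polynomial obtained for the weak
   derivative [v1]. *)
elim: k v => [|k IH] v.
  move=> [Lv [v1 wd [Lv1 vg]]] gM; subst v1.
  (* Cutting [g] to 0 where it exceeds [M] makes the bound hold everywhere, so its integral is
     Lipschitz with constant [M]. *)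
  pose D := `]x, y[ `&` [set t | `|g t| <= M]; pose G := g \_ D.
  have mD : measurable D.
    have := @measurable_fun_le _ _ R `]x, y[ (fun t => `|g t|) (cst M).
    apply; [exact: measurable_itv|apply: measurableT_comp => //; exact: Lv1.1|exact: measurable_cst].
  have GM t : `|G t| <= M.
    by rewrite /G patchE; case: ifPn; [rewrite inE => -[]|rewrite normr0].
  have mG S : measurable_fun S G.
    apply: measurable_funTS; apply/(measurable_restrictT _ mD).
    by apply: measurable_funS Lv1.1; [exact: measurable_itv|move=> t []].
  have iG t : lebesgue_measure.-integrable `[x, t] (EFin \o G).
    apply: measurable_bounded_integrable => //; first exact: lebesgue_measure_itv_lty.
    exact: mG.
    by exists M; split; [exact: num_real|move=> z Mz s _; exact: le_trans (GM s) (ltW Mz)].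
  have [|c Hc] := weak_deriv_ae_integral xy (Linf_integrable xy Lv) (Linf_integrable xy Lv1) wd (iG y).
    apply: filterS gM => t H txy; rewrite /G patchE mem_set //; split => //; exact: H.
  exists (fun t => c + \int[lebesgue_measure]_(z in `[x, t]) G z), c%:P; split => //.
  - move=> t; apply: cvgD; first exact: cvg_cst.
    by have := parameterized_integral_continuous (ltW xy) (iG y); exact.
  - exact: size_polyC_leq1.
  - move=> t; rewrite in_itv /= => /andP[xt ty].
    rewrite hornerC addrAC subrr add0r expr1.
    apply: (le_trans (le_normr_Rintegral _ (iG t))) => //.
    apply: (@le_trans _ _ (\int[lebesgue_measure]_(z in `[x, t]) cst M z)).
      apply: le_Rintegral => //; first exact: integrable_norm (iG t).
      apply: measurable_bounded_integrable => //; first exact: lebesgue_measure_itv_lty.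
      by exists `|M|; split; [exact: num_real|move=> z Mz s _; exact: ltW].
    rewrite Rintegral_cst //= lebesgue_measure_itv /= lte_fin.
    case: ifP => _; last by rewrite mulr0 mulr_ge0.
    by rewrite -EFinD /= ler_wpM2l // lerD2r.
move=> [Lv [v1 wd Hv1]] gM.
have Lv1 : Linf x y v1 by case: Hv1.
have [F1 [p1 [cF1 sp1 v1F1 B1 _]]] := IH v1 Hv1 gM.
have iF1 : lebesgue_measure.-integrable `[x, y] (EFin \o F1).
  by apply: continuous_compact_integrable => //; exact: segment_compact.
have [c Hc] := weak_deriv_ae_integral xy (Linf_integrable xy Lv) (Linf_integrable xy Lv1) wd iF1 v1F1.
pose F t := c + \int[lebesgue_measure]_(z in `[x, t]) F1 z.
(* The primitive of [p1] with value [c] at [x], so that F - p vanishes at [x]. *)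
pose p := c%:P + (polyint p1 - ((polyint p1).[x])%:P).
have cF : {within `[x, y], continuous F}.
  move=> t; apply: cvgD; first exact: cvg_cst.
  by have := parameterized_integral_continuous (ltW xy) iF1; exact.
have dp : p^`() = p1 by rewrite /p !(derivD, derivN, derivC) deriv_polyint; ring.
have dF t : t \in `]x, y[ -> is_derive t 1 F (F1 t).
  move=> txy; have := txy; rewrite in_itv /= => /andP[xt ty].
  have cF1t : {for t, continuous F1}.
    have /(continuous_within_itvP _ xy)[H _ _] := cF1; exact: H.
  have [d1 d2] := continuous_FTC1_closed ty iF1 xt cF1t.
  rewrite -[F1 t]add0r; apply: is_deriveD.
  by apply: DeriveDef => //; rewrite -derive1E.
exists F, p; split => //.
- apply: (leq_trans (size_polyD _ _)); rewrite geq_max (leq_trans (size_polyC_leq1 _)) //=.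
  apply: (leq_trans (size_polyD _ _)); rewrite geq_max size_polyN (leq_trans (size_polyC_leq1 _)) // andbT.
  by apply: (leq_trans (size_polyint _)).
- move=> t; rewrite in_itv /= => /andP[xt ty].
  (* The mean value theorem for F - p bounds it by the previous remainder times t - x, which is the
     extra power of y - x. *)
  have [||s sxt E] := @MVT_segment R (F \- horner p) (F1 \- horner p1) x t xt.
  + move=> s; rewrite in_itv /= => /andP[xs st].
    have sxy : s \in `]x, y[ by rewrite in_itv /= xs (lt_le_trans st ty).
    have dFs := dF s sxy; have := is_derive_poly p s; rewrite dp => dps.
    exact: is_deriveB.
  + move=> s; apply: cvgB; last by apply: continuous_subspaceT => z; exact: continuous_horner.
    have sub : `[x, t] `<=` `[x, y].
      by move=> z /=; rewrite !in_itv /= => /andP[-> zt]; exact: le_trans zt ty.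
    exact: (continuous_subspaceW sub cF).
  have F0 : (F \- horner p) x = 0.
    rewrite /= /F /p set_itv1 Rintegral_set1 !(hornerD, hornerN, hornerC); ring.
  have -> : F t - p.[t] = (F1 s - p1.[s]) * (t - x).
    by move: E; rewrite F0 subr0.
  rewrite normrM exprSr mulrA (ger0_norm (_ : 0 <= t - x)) ?subr_ge0 //.
  move: sxt; rewrite in_itv /= => /andP[xs st].
  apply: ler_pM => //; [by rewrite subr_ge0|apply: B1|by rewrite lerD2r].
  by rewrite in_itv /= xs (le_trans st ty).
- move=> _ t txy; have dFt := dF t txy; split; first by case: dFt.
  rewrite derive1E; have [_ ->] := dFt; rewrite dp; apply: B1.
  by move: txy; rewrite !in_itv /= => /andP[/ltW -> /ltW ->].
Qed.

(** * The finite volume scheme *)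

Lemma derive1_eq_itvoo (R : realType) (x y t : R) (f F : R -> R) :
  (forall z, z \in `]x, y[ -> f z = F z) -> t \in `]x, y[ ->
  derive1 f t = derive1 F t.
Proof.
move=> fF txy; rewrite !derive1E; apply: near_eq_derive.
by apply: filterS (near_in_itvoo txy) => z; exact: fF.
Qed.

(** Composition with the affine map from [-1, 1] onto the cell does not raise the degree. *)
Lemma cell_quadrature (R : realType) (r : nat) (G A : nat -> R) (x y : R) (p : {poly R}) :
  (forall p : {poly R}, (size p <= (2 * r).+1)%N ->
    p.[1] - p.[-1] = \sum_(1 <= j < r.+1) A j * p^`().[G j]) ->
  (size p <= (2 * r).+1)%N ->
  p.[y] - p.[x] =
    \sum_(1 <= j < r.+1) (y - x) / 2 * A j * p^`().[(y + x + (y - x) * G j) / 2].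
Proof.
move=> qA sp.
pose l : {poly R} := ((y - x) / 2) *: 'X + ((y + x) / 2)%:P.
have lE t : l.[t] = (y + x + (y - x) * t) / 2.
  by rewrite /l !(hornerD, hornerZ, hornerX, hornerC); field.
have sl : (size l <= 2)%N.
  apply: (leq_trans (size_polyD _ _)); rewrite geq_max (leq_trans (size_polyC_leq1 _)) // andbT.
  by apply: (leq_trans (size_scale_leq _ _)); rewrite size_polyX.
have spl : (size (p \Po l) <= (2 * r).+1)%N.
  apply: (leq_trans (size_comp_poly_leq _ _)); rewrite ltnS.
  have : ((size p).-1 * (size l).-1 <= (size p).-1 * 1)%N by rewrite leq_mul2l; apply/orP; right; lia.
  by rewrite muln1 => /leq_trans; apply; lia.
have dl : l^`() = ((y - x) / 2)%:P by rewrite /l derivD derivZ derivX derivC addr0 alg_polyC.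
have := qA _ spl; rewrite !horner_comp !lE.
rewrite (_ : (y + x + (y - x) * 1) / 2 = y); last by field.
rewrite (_ : (y + x + (y - x) * -1) / 2 = x); last by field.
move=> ->; apply: eq_bigr => j _.
by rewrite deriv_comp dl hornerM hornerC horner_comp lE; ring.
Qed.

(** * Test functions of a single dual cell, and increments of the flux *)

Lemma big_nat_delta (R : realType) (n k : nat) (F : nat -> R) :
  (1 <= k <= n)%N -> \sum_(1 <= i < n.+1) (i == k)%:R * F i = F k.
Proof.
move=> kn; rewrite (bigD1_seq k) ?mem_index_iota ?iota_uniq //=.
rewrite eqxx mul1r big1 ?addr0 // => i /negPf ->; exact: mul0r.
Qed.

Lemma big_nat_delta2 (R : realType) (n : nat) (m : nat -> nat) (k l : nat) (F : nat -> nat -> R) :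
  (1 <= k <= n)%N -> (1 <= l <= m k)%N ->
  \sum_(1 <= i < n.+1) \sum_(1 <= j < (m i).+1) ((i == k) && (j == l))%:R * F i j = F k l.
Proof.
move=> kn lm; rewrite -(@big_nat_delta R (m k) l (F k)) //.
rewrite -(@big_nat_delta R n k (fun i => \sum_(1 <= j < (m i).+1) (j == l)%:R * F i j)) //.
apply: eq_bigr => i _; rewrite mulr_sumr; apply: eq_bigr => j _.
by rewrite mulrA -natrM mulnb.
Qed.

Definition dual_unit (R : realType) (i j : nat) : nat -> nat -> R :=
  fun i' j' => ((i' == i) && (j' == j))%:R.

Lemma dual_count_leq (r N i : nat) : (dual_count r N i <= r)%N.
Proof. by rewrite /dual_count; case: eqP => _; rewrite ?leq_pred. Qed.

Lemma gauss_point_wrap (R : realType) (r : nat) (G x : nat -> R) (i : nat) : (0 < r)%N ->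
  gauss_point r G x i r.+1 = gauss_point r G x i.+1 1.
Proof. by move=> r0; rewrite /gauss_point eqxx; case: eqP => // -[]; lia. Qed.

(** A single unit coefficient has two non-zero jumps: 1 at its own Gauss point and -1 at the next
    one. *)
Lemma fv_form_dual_unit (R : realType) (r N i j : nat) (G x : nat -> R) (alpha v : R -> R) :
  (0 < r)%N -> (1 <= i <= N)%N -> (1 <= j <= dual_count r N i)%N ->
  let flux k := alpha (gauss_point r G x i k) * derive1 v (gauss_point r G x i k) in
  fv_form r N G x alpha v (dual_unit R i j) = flux j - flux j.+1.
Proof.
move=> r0 iN jd flux; have jr := leq_trans (proj2 (andP jd)) (dual_count_leq r N i).
pose Phi i j := alpha (gauss_point r G x i j) * derive1 v (gauss_point r G x i j).
(* Index of the next Gauss point, in the following cell when [j] is [r]; [dual_count] guarantees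
   that this cell exists. *)
pose i' := if j == r then i.+1 else i; pose j' := if j == r then 1%N else j.+1.
have fluxS : flux j.+1 = Phi i' j'.
  rewrite /flux /i' /j' /Phi; case: eqP => [->|//].
  by rewrite gauss_point_wrap.
have iN' : (1 <= i' <= N)%N.
  rewrite /i'; case: eqP => [jr'|//]; move: jd; rewrite jr' /dual_count; case: eqP; lia.
have jr'' : (1 <= j' <= r)%N by rewrite /j'; case: eqP; lia.
rewrite fluxS -[flux j]/(Phi i j) -(@big_nat_delta2 R N (fun=> r) i j Phi) //; last by lia.
rewrite -(@big_nat_delta2 R N (fun=> r) i' j' Phi) // -sumrB /fv_form.
apply: eq_big_nat => k kN; rewrite -sumrB; apply: eq_big_nat => l lr.
rewrite -mulrBl -/(Phi k l); congr (_ * _).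
(* The chosen index is never (N, r), whose coefficient is forced to be 0. *)
have iNr : (i == N) ==> (j < r)%N by apply/implyP => /eqP E; move: jd; rewrite E /dual_count eqxx; lia.
rewrite /jump /test_coef /dual_unit; congr (_ - _).
  rewrite ifF; last by apply/eqP; lia.
  case: ifP => // /andP[/eqP -> /eqP ->]; rewrite (_ : _ && _ = false) //.
  by apply/negbTE/negP => /andP[/eqP E /eqP F]; move: iNr; rewrite -E -F eqxx ltnn.
(* For l = 1 the coefficient subtracted in the jump is the last one of the preceding cell, or 0 in
   the first cell. *)
case: (l =P 1%N) => [->|l1].
  rewrite /= /i' /j'; case: (k =P 1%N) => [->|k1].
    rewrite (_ : _ && _ = false) //.
    by case: (j =P r) => jr'; apply/negbTE/negP => /andP[/eqP E /eqP F]; lia.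
  by congr (nat_of_bool _)%:R; case: (j =P r) => jr'; lia.
rewrite ifF; last by apply/eqP; lia.
rewrite ifF; last by apply/andP => -[_ /eqP]; lia.
by congr (nat_of_bool _)%:R; rewrite /i' /j'; case: (j =P r) => jr'; lia.
Qed.

Lemma test_fun_dual_unit (R : realType) (r N i j : nat) (G x : nat -> R) :
  (1 <= i <= N)%N -> (1 <= j <= dual_count r N i)%N ->
  test_fun r N G x (dual_unit R i j) =
  \1_(`[gauss_point r G x i j, gauss_point r G x i j.+1]).
Proof.
move=> iN jd; apply/funext => t.
rewrite -(@big_nat_delta2 R N (dual_count r N) i j
  (fun i j => \1_(`[gauss_point r G x i j, gauss_point r G x i j.+1]) t)) //.
Qed.

(** Continuity of [q] turns the a.e. representation as an indefinite integral into an identity at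
    every point of [a, b], in particular at Gauss points. *)
Lemma weak_deriv_increment (R : realType) (a b : R) (q f : R -> R) : a < b ->
  {within `[a, b], continuous q} -> lebesgue_measure.-integrable `[a, b] (EFin \o f) ->
  weak_deriv a b q (fun t => - f t) ->
  forall s s', a <= s -> s <= s' -> s' <= b ->
  \int[lebesgue_measure]_(t in `[a, b]) (f t * \1_(`[s, s']) t) = q s - q s'.
Proof.
move=> ab cq itf wd s s' sa ss' s'b.
have mc (c d : R) : measurable (`[c, d]%classic : set R) by exact: measurable_itv.
have mo : measurable (`]a, b[%classic : set R) by exact: measurable_itv.
have ooc : `]a, b[ `<=` `[a, b] by exact: subset_itv_oo_cc.
have iN : lebesgue_measure.-integrable `[a, b] (EFin \o (fun t => - f t)).
  by have := integrableN itf; apply: eq_integrable.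
have iq : lebesgue_measure.-integrable `[a, b] (EFin \o q).
  by apply: continuous_compact_integrable => //; exact: segment_compact.
have [|||c Hc] := weak_deriv_ae_integral ab _ _ wd iN.
- exact: integrableS iq.
- exact: integrableS iN.
- exact: aeW.
pose F t := c + \int[lebesgue_measure]_(z in `[a, t]) (- f z).
have cF : {within `[a, b], continuous F}.
  move=> t; apply: cvgD; first exact: cvg_cst.
  by have := parameterized_integral_continuous (ltW ab) iN; exact.
have qF := ae_eq_within_continuous cq cF ab Hc.
rewrite (qF s) ?in_itv /= ?sa ?(le_trans ss' s'b) //.
rewrite (qF s') ?in_itv /= ?s'b ?(le_trans sa ss') // /F.
have sub : `[s, s'] `<=` `[a, b].
  by move=> t /=; rewrite !in_itv /= => /andP[st ts]; rewrite (le_trans sa) ?(le_trans ts).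
have isub t : t <= b -> lebesgue_measure.-integrable `[a, t] (EFin \o (fun t => - f t)).
  move=> tb; apply: integrableS iN => // z /=; rewrite !in_itv /= => /andP[-> zt].
  exact: le_trans zt tb.
have := @Rintegral_itvB R (fun t => - f t) (BLeft a) (BRight s') s (isub s' s'b).
rewrite !bnd_simp => /(_ sa ss') => E.
have -> : \int[lebesgue_measure]_(t in `[a, b]) (f t * \1_(`[s, s']) t) =
    \int[lebesgue_measure]_(t in `[s, s']) f t.
  rewrite -(setIidr sub) Rintegral_mkcondr; apply: eq_Rintegral => t _.
  by rewrite patchE indicE (setIidr sub); case: ifPn => _; rewrite ?mulr1 ?mulr0.
suff : \int[lebesgue_measure]_(t in `]s, s']) (- f t) =
    - \int[lebesgue_measure]_(t in `[s, s']) f t by move: E; lra.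
rewrite Rintegral_itv_obnd_cbnd; last first.
  apply: integrableS iN => //; apply: subset_trans sub; exact: subset_itv_oc_cc.
under eq_Rintegral do rewrite -mulN1r.
by rewrite RintegralZl ?mulN1r //; exact: integrableS itf.
Qed.

Lemma weak_derivn_Linf (R : realType) (x y : R) (m : nat) (v g : R -> R) :
  weak_derivn x y m v g -> Linf x y g.
Proof.
elim: m v => [|m IH] v /=; first by case=> Lv ->.
by case=> _ [v1 _]; exact: IH.
Qed.

(** * Flux error and quadrature error on a mesh *)

Section Mesh.
Variables (R : realType) (a b : R) (r N : nat) (G x : nat -> R).
Hypotheses (r0 : (0 < r)%N) (hG : legendre_zeros r G) (mx : is_mesh a b N x).

Lemma mesh_le (i k : nat) : (i <= k)%N -> (k <= N)%N -> x i <= x k.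
Proof.
elim: k => [|k IH]; first by rewrite leqn0 => /eqP ->.
rewrite leq_eqVlt => /predU1P[-> //|ik kN].
by apply: le_trans (IH ik (ltnW kN)) _; have [_ _ /(_ k.+1) /= H] := mx; apply/ltW/H; lia.
Qed.

Lemma mesh_cell_sub (i : nat) (t : R) : (1 <= i <= N)%N ->
  t \in `[x i.-1, x i] -> t \in `[a, b].
Proof.
move=> iN; rewrite !in_itv /= => /andP[xt tx]; have [<- <- _] := mx.
by rewrite (le_trans _ xt) ?(le_trans tx) //; apply: mesh_le; lia.
Qed.

Lemma mesh_cell_lt (i : nat) : (1 <= i <= N)%N -> x i.-1 < x i.
Proof. by have [_ _] := mx; exact. Qed.

Lemma gauss_pointE (i j : nat) : (j <= r)%N ->
  gauss_point r G x i j = (x i + x i.-1 + (x i - x i.-1) * G j) / 2.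
Proof. by move=> jr; rewrite /gauss_point ifF //; apply/eqP; lia. Qed.

Lemma gauss_point_itv (i j : nat) : (1 <= i <= N)%N -> (1 <= j <= r)%N ->
  gauss_point r G x i j \in `]x i.-1, x i[.
Proof.
move=> iN jr; rewrite gauss_pointE; last by case/andP: jr.
have /andP[? ?] := legendre_zeros_itv hG jr; have ? := mesh_cell_lt iN.
by rewrite in_itv /=; apply/andP; split; nra.
Qed.

Lemma gauss_point_ab (i j : nat) : (1 <= i <= N)%N -> (1 <= j <= r)%N ->
  gauss_point r G x i j \in `[a, b].
Proof.
move=> iN jr; apply: (mesh_cell_sub iN); have := gauss_point_itv iN jr.
by rewrite !in_itv /= => /andP[/ltW -> /ltW ->].
Qed.

Lemma gauss_pointS_le (i j : nat) : (1 <= i <= N)%N -> (1 <= j <= dual_count r N i)%N ->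
  gauss_point r G x i j <= gauss_point r G x i j.+1 /\ gauss_point r G x i j.+1 <= b.
Proof.
move=> iN jd; have jr := leq_trans (proj2 (andP jd)) (dual_count_leq r N i).
have := gauss_point_itv iN (_ : (1 <= j <= r)%N); rewrite in_itv /= => /(_ _)/andP[|_ gx]; first by lia.
case: (j =P r) => jr'.
  have iN' : (1 <= i.+1 <= N)%N by move: jd; rewrite jr' /dual_count; case: eqP; lia.
  have r1 : (1 <= 1 <= r)%N by lia.
  rewrite {2 3}jr' gauss_point_wrap //; split.
    have := gauss_point_itv iN' r1; rewrite in_itv /= => /andP[xg _].
    exact/ltW/(lt_trans gx).
  by have := gauss_point_ab iN' r1; rewrite in_itv /= => /andP[].
have jr2 : (1 <= j.+1 <= r)%N by lia.
split; last by have := gauss_point_ab iN jr2; rewrite in_itv /= => /andP[].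
have ? : G j < G j.+1 by apply: hG.1; lia.
by rewrite !gauss_pointE; [have := mesh_cell_lt iN; nra|lia|lia].
Qed.

Lemma cell_size_le_mesh_size (i : nat) : (1 <= i <= N)%N ->
  x i - x i.-1 <= mesh_size N x.
Proof.
move=> iN; rewrite /mesh_size.
by apply: (@le_bigmax_seq _ _ _ _ _ i xpredT (cell_size x)); rewrite ?mem_index_iota.
Qed.

Lemma sum_cell_diff (u : R -> R) :
  \sum_(1 <= i < N.+1) (u (x i) - u (x i.-1)) = u b - u a.
Proof.
have [<- <- _] := mx; rewrite big_add1 /=.
by rewrite (telescope_sumr (fun i => u (x i))).
Qed.

Lemma flux_error_const (alpha f u uP : R -> R) : a < b ->
  bvp_solution a b N x alpha f u -> fv_solution a b r N G x alpha f uP ->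
  exists c : R, forall i j, (1 <= i <= N)%N -> (1 <= j <= r)%N ->
    alpha (gauss_point r G x i j) * (derive1 u (gauss_point r G x i j) -
      derive1 uP (gauss_point r G x i j)) = c.
Proof.
move=> ab [_ _ itf [q [cq wq qE]]] [_ fv].
pose D i j := alpha (gauss_point r G x i j) * (derive1 u (gauss_point r G x i j) -
      derive1 uP (gauss_point r G x i j)).
exists (D 1%N 1%N) => i j iN jr; rewrite -/(D i j).
have qg k l : (1 <= k <= N)%N -> (1 <= l <= r)%N ->
    q (gauss_point r G x k l) = alpha (gauss_point r G x k l) * derive1 u (gauss_point r G x k l).
  by move=> kN lr; apply: (qE k) => //; exact: gauss_point_itv.
(* On one dual cell, the scheme and the equation give the same increment to alpha uP' and to alpha
   u'. *)
have step k l : (1 <= k <= N)%N -> (1 <= l <= dual_count r N k)%N -> D k l = D k l.+1.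
  move=> kN ld; have lr := leq_trans (proj2 (andP ld)) (dual_count_leq r N k).
  have lr1 : (1 <= l <= r)%N by lia.
  have [gg gb] := gauss_pointS_le kN ld.
  have := fv (dual_unit R k l).
  rewrite fv_form_dual_unit // test_fun_dual_unit //.
  rewrite (weak_deriv_increment ab cq itf wq) //; last first.
    by have := gauss_point_ab kN lr1; rewrite in_itv /= => /andP[].
  rewrite qg // => E.
  suff : q (gauss_point r G x k l.+1) =
      alpha (gauss_point r G x k l.+1) * derive1 u (gauss_point r G x k l.+1).
    by move=> q2; rewrite /D; move: E; rewrite q2; lra.
  case: (l =P r) => lr'; last by apply: qg => //; lia.
  rewrite {1 2 3}lr' gauss_point_wrap //; apply: qg; last by lia.
  by move: ld; rewrite lr' /dual_count; case: eqP; lia.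
have row k l : (1 <= k <= N)%N -> (1 <= l <= r)%N -> D k l = D k 1%N.
  move=> kN; elim: l => // -[//|l] IH lr.
  rewrite -IH; last by lia.
  by apply/esym/step => //; rewrite /dual_count; case: eqP; lia.
(* Cells are linked by the dual cell of index [r], which straddles a node and ends at the first
   Gauss point of the next cell. *)
rewrite row //; elim: i iN => // -[//|i] IH iN.
rewrite -IH; last by lia.
rewrite -(row i.+1 r); [|lia|lia].
rewrite (step i.+1 r); [|lia|rewrite /dual_count; case: eqP; lia].
by rewrite /D gauss_point_wrap.
Qed.

(** The weak derivative lies in L^oo on each of finitely many cells, so the maximum is a real
    number, which bounds all of them at once. *)
Lemma broken_seminorm_fin_num (m : nat) (u : R -> R) :
  broken_Winf a b N x m u -> exists2 M, 0 <= M &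
    broken_seminorm N x m u = M%:E /\
    forall i, (1 <= i <= N)%N -> exists2 g, weak_derivn (x i.-1) (x i) m u g &
      {ae lebesgue_measure, forall t, t \in `]x i.-1, x i[ -> `|g t| <= M}.
Proof.
move=> [_ hW].
(* A weak derivative exists, so [xget] does not return its default. *)
have wg i : (1 <= i <= N)%N ->
    weak_derivn (x i.-1) (x i) m u (xget (cst 0) [set g | weak_derivn (x i.-1) (x i) m u g]).
  by move=> iN; apply: (@xgetPex _ (cst 0) [set g | weak_derivn (x i.-1) (x i) m u g]); exact: hW.
have /andP[] : (0 <= broken_seminorm N x m u < +oo)%E.
  rewrite /broken_seminorm big_nat; apply: (@big_ind _ (fun z => 0 <= z < +oo)%E).
  - by rewrite lexx ltry.
  - by move=> y z /andP[y0 yoo] /andP[z0 zoo]; rewrite le_max y0 gt_max yoo zoo.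
  move=> i iN; rewrite Linf_norm_ge0 /=.
  have : Linf (x i.-1) (x i) (xget (cst 0) [set g | weak_derivn (x i.-1) (x i) m u g]).
    exact: weak_derivn_Linf (wg i iN).
  by case.
case E : (broken_seminorm N x m u) => [M| |] // M0 _.
exists M; first by rewrite -lee_fin.
split=> // i iN; exists (xget (cst 0) [set g | weak_derivn (x i.-1) (x i) m u g]); first exact: wg.
apply: Linf_norm_ae; first exact: mesh_cell_lt.
rewrite -E /broken_seminorm.
by apply: (@le_bigmax_seq _ _ _ _ _ i xpredT (fun i => Winf_seminorm (x i.-1) (x i) m u)); rewrite ?mem_index_iota.
Qed.

Lemma within_cell (u : R -> R) (i : nat) : (1 <= i <= N)%N ->
  {within `[a, b], continuous u} -> {within `[x i.-1, x i], continuous u}.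
Proof.
move=> iN; apply: continuous_subspaceW => t tI; exact: (mesh_cell_sub iN).
Qed.

Variable A : nat -> R.
Hypotheses (A0 : forall j, (1 <= j <= r)%N -> 0 <= A j)
  (qA : forall p : {poly R}, (size p <= (2 * r).+1)%N ->
    p.[1] - p.[-1] = \sum_(1 <= j < r.+1) A j * p^`().[G j]).

(** The rule applied to ['X], a primitive of 1. *)
Lemma sum_weights : \sum_(1 <= j < r.+1) A j = 2.
Proof.
have sX : (size ('X : {poly R}) <= (2 * r).+1)%N by rewrite size_polyX; lia.
have := qA sX; rewrite !hornerX => E.
have -> : 2 = 1 - (-1) :> R by ring.
by rewrite E; apply: eq_bigr => j _; rewrite derivX hornerC mulr1.
Qed.

(** The rule is exact for the Taylor polynomial, so only the remainder counts: once through its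
    derivative at the Gauss points and twice through the end points, hence the factor 3. *)
Lemma cell_gauss_error (u : R -> R) (i : nat) (M : R) (g : R -> R) :
  (1 <= i <= N)%N -> {within `[a, b], continuous u} -> 0 <= M ->
  weak_derivn (x i.-1) (x i) (2 * r + 1) u g ->
  {ae lebesgue_measure, forall t, t \in `]x i.-1, x i[ -> `|g t| <= M} ->
  `|\sum_(1 <= j < r.+1) (x i - x i.-1) / 2 * A j * derive1 u (gauss_point r G x i j)
    - (u (x i) - u (x i.-1))| <= 3 * M * (x i - x i.-1) ^+ (2 * r) * (x i - x i.-1).
Proof.
move=> iN cu M0; rewrite addn1 => wg gM; have xx := mesh_cell_lt iN.
have [F [p [cF sp uF B dB]]] := weak_derivn_taylor xx M0 wg gM.
(* [u] is continuous, so it equals [F] at every point of the cell and its derivative can be read off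
   [F]. *)
have uFE := ae_eq_within_continuous (within_cell iN cu) cF xx uF.
have h0 : 0 <= x i - x i.-1 by rewrite subr_ge0 ltW.
have du j : (1 <= j <= r)%N -> derive1 u (gauss_point r G x i j) = derive1 F (gauss_point r G x i j).
  move=> jr; apply: (@derive1_eq_itvoo _ (x i.-1) (x i)); last exact: gauss_point_itv.
  by move=> z zx; apply: uFE; move: zx; rewrite !in_itv /= => /andP[/ltW -> /ltW ->].
have eq_p := cell_quadrature (x i.-1) (x i) qA sp.
have xl : x i.-1 \in `[x i.-1, x i] by rewrite in_itv /= lexx ltW.
have xr : x i \in `[x i.-1, x i] by rewrite in_itv /= lexx ltW.
set h := x i - x i.-1 in h0 eq_p B dB *.
have -> : \sum_(1 <= j < r.+1) h / 2 * A j * derive1 u (gauss_point r G x i j)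
    - (u (x i) - u (x i.-1)) =
    \sum_(1 <= j < r.+1) h / 2 * A j * (derive1 F (gauss_point r G x i j)
      - p^`().[gauss_point r G x i j])
    - ((F (x i) - p.[x i]) - (F (x i.-1) - p.[x i.-1])).
  have -> : \sum_(1 <= j < r.+1) h / 2 * A j * (derive1 F (gauss_point r G x i j)
      - p^`().[gauss_point r G x i j]) =
      \sum_(1 <= j < r.+1) h / 2 * A j * derive1 u (gauss_point r G x i j)
      - (p.[x i] - p.[x i.-1]).
    rewrite eq_p -sumrB; apply: eq_big_nat => j jr.
    by rewrite -mulrBr du // gauss_pointE //; lia.
  by rewrite (uFE _ xl) (uFE _ xr); ring.
have S : `|\sum_(1 <= j < r.+1) h / 2 * A j * (derive1 F (gauss_point r G x i j)
      - p^`().[gauss_point r G x i j])| <= M * h ^+ (2 * r) * h.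
  apply: (le_trans (ler_norm_sum _ _ _)).
  (* The scaled weights sum to the length [h] of the cell. *)
  have -> : M * h ^+ (2 * r) * h = \sum_(1 <= j < r.+1) h / 2 * A j * (M * h ^+ (2 * r)).
    by rewrite -mulr_suml -mulr_sumr sum_weights; field.
  apply: ler_sum_nat => j jr; have jr' : (1 <= j <= r)%N by lia.
  have hA : 0 <= h / 2 * A j by rewrite !mulr_ge0 // A0.
  rewrite normrM (ger0_norm hA); apply: ler_wpM2l => //.
  have r2 : (0 < 2 * r)%N by lia.
  by have [] := dB r2 _ (gauss_point_itv iN jr').
have Bl := B _ xl; have Br := B _ xr; move: Bl Br; rewrite exprSr mulrA => Bl Br.
apply: (le_trans (ler_normB _ _)).
have := ler_normB (F (x i) - p.[x i]) (F (x i.-1) - p.[x i.-1]).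
rewrite -mulrA -mulrA in Bl Br S *; set K := h ^+ (2 * r) * h in Bl Br S *; lra.
Qed.

End Mesh.

(** * The error at the Gauss points *)

Theorem theorem4p8 (R : realType) (a b : R) (r : nat) (alpha0 : R)
    (alpha : R -> R) (G : nat -> R)
    (hab : a < b) (hr : (1 <= r)%N)
    (halpha : diffusion_coef a b alpha0 alpha)
    (hG : legendre_zeros r G) :
  exists2 C : R, 0 < C &
    forall (N : nat) (x : nat -> R) (f u uP : R -> R),
      is_mesh a b N x ->
      broken_Winf a b N x (2 * r + 1) u ->
      bvp_solution a b N x alpha f u ->
      fv_solution a b r N G x alpha f uP ->
      forall i j : nat, (1 <= i <= N)%N -> (1 <= j <= r)%N ->
        (`|derive1 u (gauss_point r G x i j) - derive1 uP (gauss_point r G x i j)|%:E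
         <= (C * mesh_size N x ^+ (2 * r))%:E *
            \sum_(r + 1 <= k < (2 * r + 1).+1) broken_seminorm N x k u)%E.
Proof.
have [A [A0 qA]] := gauss_quadrature hr hG.
have [_ [K [_ hK]] a0 ha] := halpha.
(* Boundedness gives a bound by every number above [K], hence [K + 1]; the 1 keeps [am] positive. *)
pose am := Num.max 1 (K + 1).
have am0 : 0 < am by rewrite lt_max ltr01.
have alpha_le t : t \in `[a, b] -> alpha t <= am.
  move=> tab; apply: (le_trans (ler_norm _)); apply: (le_trans (hK (K + 1) _ t tab)).
    by rewrite ltrDl.
  by rewrite le_max lexx orbT.
(* 3 comes from the cell error, [am] from the lower bound on the weighted sum of 1 / alpha, and
   [alpha0] from dividing the flux error by alpha. *)
exists (3 * am / alpha0); first by rewrite divr_gt0 // mulr_gt0.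
move=> N x f u uP mx hu hbvp hfv i j iN jr.
have [M M0 [EM cellM]] := broken_seminorm_fin_num mx hu.
have [c hc] := flux_error_const hr hG mx hab hbvp hfv.
have [cu _] := hu; have [ua ub _ _] := hbvp; have [[cuP uPp uPa uPb] _] := hfv.
set H := mesh_size N x.
have H0 : 0 <= H by exact: bigmax_ge_id.
pose e k l := derive1 u (gauss_point r G x k l) - derive1 uP (gauss_point r G x k l).
have alphag k l : (1 <= k <= N)%N -> (1 <= l <= r)%N ->
    0 < alpha (gauss_point r G x k l) <= am.
  move=> kN lr; have gab := gauss_point_ab hr hG mx kN lr.
  by rewrite alpha_le // andbT; apply: lt_le_trans (ha _ gab).
have ec k l : (1 <= k <= N)%N -> (1 <= l <= r)%N ->
    e k l = c / alpha (gauss_point r G x k l).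
  move=> kN lr; have /andP[a1 _] := alphag k l kN lr.
  by rewrite -(hc k l kN lr) mulrAC divff ?mul1r // gt_eqF.
have h_ge0 k : (1 <= k <= N)%N -> 0 <= x k - x k.-1.
  by move=> kN; rewrite subr_ge0 ltW // (mesh_cell_lt mx).
have hA k l : (1 <= k <= N)%N -> (1 <= l <= r)%N -> 0 <= (x k - x k.-1) / 2 * A l.
  by move=> kN lr; rewrite !mulr_ge0 ?A0 // h_ge0.
pose T := \sum_(1 <= k < N.+1) \sum_(1 <= l < r.+1) (x k - x k.-1) / 2 * A l * e k l.
have T_ub : `|T| <= 3 * M * H ^+ (2 * r) * (b - a).
  (* The rule integrates uP' exactly since r <= 2r, and the increments of [u] and of [uP] telescope
     to 0. *)
  have -> : T = \sum_(1 <= k < N.+1)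
      (\sum_(1 <= l < r.+1) (x k - x k.-1) / 2 * A l * derive1 u (gauss_point r G x k l)
       - (u (x k) - u (x k.-1))).
    rewrite sumrB (sum_cell_diff mx u) ua ub subrr subr0.
    have := sum_cell_diff mx uP; rewrite uPa uPb subrr => E.
    rewrite -[RHS]subr0 -[X in _ = _ - X]E -sumrB; apply: eq_big_nat => k kN.
    have kN' : (1 <= k <= N)%N by lia.
    have [p sp uPE] := uPp k kN'; have xx := mesh_cell_lt mx kN'.
    have sp' : (size p <= (2 * r).+1)%N by lia.
    rewrite (uPE (x k)) ?(uPE (x k.-1)) ?in_itv /= ?lexx ?(ltW xx) //.
    rewrite (cell_quadrature _ _ qA sp') -sumrB; apply: eq_big_nat => l lr.
    have lr' : (1 <= l <= r)%N by lia.
    rewrite -mulrBr /e -(gauss_pointE G x hr); last by case/andP: lr'.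
    rewrite (@derive1_eq_itvoo _ (x k.-1) (x k) _ uP (horner p)) -?derivE //.
      by move=> z zx; apply: uPE; move: zx; rewrite !in_itv /= => /andP[/ltW -> /ltW ->].
    exact: (gauss_point_itv hr hG mx).
  apply: (le_trans (ler_norm_sum _ _ _)).
  have <- : \sum_(1 <= k < N.+1) 3 * M * H ^+ (2 * r) * (x k - x k.-1) =
      3 * M * H ^+ (2 * r) * (b - a).
    by rewrite -mulr_sumr (sum_cell_diff mx id).
  apply: ler_sum_nat => k kN; have kN' : (1 <= k <= N)%N by lia.
  have [g wg gM] := cellM k kN'.
  apply: (le_trans (cell_gauss_error hr hG mx A0 qA kN' cu M0 wg gM)).
  apply: ler_wpM2r; first exact: h_ge0.
  apply: ler_wpM2l; first by rewrite mulr_ge0.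
  by apply: lerXn2r; rewrite ?nnegrE ?h_ge0 //; exact: cell_size_le_mesh_size.
(* The errors are c / alpha, all of the same sign; the weights are non-negative with sum b - a, and
   1 / alpha is at least 1 / am. *)
have T_lb : `|c| / am * (b - a) <= `|T|.
  have -> : T = c * \sum_(1 <= k < N.+1) \sum_(1 <= l < r.+1)
      (x k - x k.-1) / 2 * A l / alpha (gauss_point r G x k l).
    rewrite mulr_sumr; apply: eq_big_nat => k kN.
    rewrite mulr_sumr; apply: eq_big_nat => l lr.
    by rewrite ec; [ring|lia|lia].
  rewrite normrM -mulrA; apply: ler_wpM2l => //; apply: le_trans (ler_norm _).
  have <- : \sum_(1 <= k < N.+1) \sum_(1 <= l < r.+1)
      (x k - x k.-1) / 2 * A l / am = am^-1 * (b - a).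
    rewrite -(sum_cell_diff mx id) mulr_sumr; apply: eq_big_nat => k kN.
    rewrite -mulr_suml -mulr_sumr (sum_weights hr qA); field.
    by rewrite gt_eqF.
  apply: ler_sum_nat => k kN; apply: ler_sum_nat => l lr.
  have kN' : (1 <= k <= N)%N by lia. have lr' : (1 <= l <= r)%N by lia.
  have /andP[a1 a2] := alphag k l kN' lr'.
  by apply: ler_wpM2l; [exact: hA|rewrite lef_pV2 ?posrE].
have c_ub : `|c| <= 3 * am * M * H ^+ (2 * r).
  have ba : 0 < b - a by rewrite subr_gt0.
  have := le_trans T_lb T_ub; rewrite ler_pM2r // ler_pdivrMr // => Hc.
  by apply: (le_trans Hc); rewrite le_eqVlt; apply/orP; left; apply/eqP; ring.
have err : `|e i j| <= 3 * am / alpha0 * H ^+ (2 * r) * M.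
  have /andP[a1 _] := alphag i j iN jr.
  rewrite ec // normrM normfV (gtr0_norm a1) ler_pdivrMr //.
  apply: (le_trans c_ub).
  have -> : 3 * am * M * H ^+ (2 * r) = 3 * am / alpha0 * H ^+ (2 * r) * M * alpha0.
    by field; rewrite gt_eqF.
  apply: ler_wpM2l; last exact/ha/(gauss_point_ab hr hG mx).
  by rewrite !mulr_ge0 ?exprn_ge0 ?invr_ge0 // ltW.
rewrite -/(e i j); apply: (@le_trans _ _ ((3 * am / alpha0 * H ^+ (2 * r))%:E * M%:E)%E).
  by rewrite -EFinM lee_fin.
apply: lee_wpmul2l.
  by rewrite lee_fin !mulr_ge0 ?exprn_ge0 ?invr_ge0 // ltW.
(* [M] is the last term of the sum, k = 2r + 1; the others are non-negative. *)
rewrite big_nat_recr /=; last by lia.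
rewrite EM leeDr //; apply: sume_ge0 => k _; exact: bigmax_ge_id.
Qed.
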